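(* Let $n \geq 3$ and let $K \subset \mathbb{R}^n$ be a symmetric convex body. Then $K$ is intuitive if and only if $K$ is an ellipsoid.
   Context: A symmetric convex body $K \subset \mathbb{R}^n$ is a compact convex set with non-empty interior such that $K = -K$. It defines the norm $\|\xi\|_K = \inf\{t > 0 : \xi \in tK\}$ on $\mathbb{R}^n$. For a finite set $P \subset \mathbb{R}^n$, $\Delta_P$ denotes the set of probability distributions on $P$ (weights $W(p)\ge 0$ for $p \in P$ summing to $1$). For $W \in \Delta_P$, the geometric median $\mathsf{GM}_K(W)$ is the set of all minimizers over $\xi \in \mathbb{R}^n$ of the function $F_{K,W}(\xi) = \sum_{p \in P} W(p)\,\|\xi - p\|_K$. $\mathsf{conv}(P)$ is the convex hull of $P$. The body $K$ is called intuitive if for every finite non-empty $P \subset \mathbb{R}^n$ and every $W \in \Delta_P$ one has $\mathsf{GM}_K(W) \cap \mathsf{conv}(P) \neq \emptyset$. An ellipsoid is the image of the closed Euclidean unit ball of $\mathbb{R}^n$ under an invertible affine map (for symmetric $K$ it is necessarily centered at the origin, i.e. the image of the ball under an invertible linear map). *)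

(* Defs.v *)
From mathcomp Require Import all_boot all_order all_algebra finmap.
From mathcomp Require Import all_classical all_reals all_analysis.

Set Implicit Arguments.
Unset Strict Implicit.
Unset Printing Implicit Defensive.

Import Order.TTheory GRing.Theory Num.Theory numFieldNormedType.Exports.

Local Open Scope classical_set_scope.
Local Open Scope ring_scope.

Definition symmetric_convex_body (R : realType) (n : nat) (K : set 'rV[R]_n) :=
  [/\ compact K, convex_set K, interior K !=set0 & [set - x | x in K] = K].

Definition norm_body (R : realType) (n : nat) (K : set 'rV[R]_n)
    (xi : 'rV[R]_n) : R :=
  inf [set t : R | 0 < t /\ [set t *: x | x in K] xi].

(* Weights are functions on the whole space; only their restriction to P is
   constrained here and used below. *)
Definition prob_weights (R : realType) (n : nat) (P : {fset 'rV[R]_n})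
    (W : 'rV[R]_n -> R) : Prop :=
  (forall p, p \in P -> 0 <= W p) /\ \sum_(p <- P) W p = 1.

Definition GM_cost (R : realType) (n : nat) (K : set 'rV[R]_n)
    (P : {fset 'rV[R]_n}) (W : 'rV[R]_n -> R) (xi : 'rV[R]_n) : R :=
  \sum_(p <- P) W p * norm_body K (xi - p).

Definition geometric_median (R : realType) (n : nat) (K : set 'rV[R]_n)
    (P : {fset 'rV[R]_n}) (W : 'rV[R]_n -> R) : set 'rV[R]_n :=
  [set xi | forall eta, GM_cost K P W xi <= GM_cost K P W eta].

Definition convex_hull (R : realType) (n : nat) (A : set 'rV[R]_n) :
    set 'rV[R]_n :=
  smallest [set B : set 'rV[R]_n | convex_set B] A.

Definition intuitive (R : realType) (n : nat) (K : set 'rV[R]_n) : Prop :=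
  forall (P : {fset 'rV[R]_n}) (W : 'rV[R]_n -> R),
    P != fset0 -> prob_weights P W ->
    geometric_median K P W `&` convex_hull [set` P] !=set0.

(* The norm [`|x|] carried by ['rV[R]_n] is the sup norm, hence this one. *)
Definition euclidean_norm (R : realType) (n : nat) (x : 'rV[R]_n) : R :=
  Num.sqrt (\sum_(i < n) x 0 i ^+ 2).

Definition ellipsoid (R : realType) (n : nat) (E : set 'rV[R]_n) : Prop :=
  exists (A : 'M[R]_n) (b : 'rV[R]_n),
    A \in unitmx /\
    E = [set x *m A + b | x in [set x | euclidean_norm x <= 1]].

(* Main.v *)
Require Import Defs.
From mathcomp Require Import all_boot all_order all_algebra finmap.
From mathcomp Require Import all_classical all_reals all_analysis.
From mathcomp Require Import ring lra.

(* Intuitive implies ellipsoid. The optimality condition for a minimax problem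
   shows that for every subspace M and every point z some m in M satisfies
   |m - p| <= |z - p| for all p in M, since otherwise suitable weights on
   finitely many points of M would push the medians off M; so every subspace is
   the range of a norm-one projection, as in Kakutani's characterization of
   Euclidean norms. Let x be a unit vector at which a Euclidean ball touches the
   unit ball from inside, with tangent hyperplane x + H. Projecting onto the
   planes span(x, e), e in H, gives directions in H that support, at e, both the
   norm and each of its slices N(s x + .);
     as n >= 3, one can travel from e to -e
   inside H, whence N(s x + e) = N(s x - e): the reflection fixing x and
   reversing H is an isometry. Such x are dense, so by compactness every nonzero
   vector is fixed by such a reflection. On a plane, the quadratic form of
   largest discriminant below N^2 is unique, hence invariant under all the
   reflections, and these act transitively on its level curves; so N^2 is
   quadratic on each plane. In an Auerbach basis, which is then orthonormal, N
   becomes the Euclidean norm.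

   Ellipsoid implies intuitive: the Euclidean nearest-point projection onto the
   convex hull of P brings a point closer to every point of P. *)

Set Implicit Arguments.
Unset Strict Implicit.
Unset Printing Implicit Defensive.

Import Order.TTheory GRing.Theory Num.Theory numFieldNormedType.Exports.

Local Open Scope classical_set_scope.
Local Open Scope ring_scope.

(** * Continuity, norms and the Euclidean inner product *)

Section Continuity.
Variables (R : realType) (T : topologicalType).

Lemma mulf_continuous (f g : T -> R) :
  continuous f -> continuous g -> continuous (fun t => f t * g t).
Proof. by move=> cf cg t; apply: continuousM; [exact: cf|exact: cg]. Qed.

Lemma addf_continuous (f g : T -> R) :
  continuous f -> continuous g -> continuous (fun t => f t + g t).
Proof. by move=> cf cg t; apply: continuousD; [exact: cf|exact: cg]. Qed.

Lemma oppf_continuous (f : T -> R) :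
  continuous f -> continuous (fun t => - f t).
Proof. by move=> cf t; apply: continuousN; exact: cf. Qed.

Lemma normf_continuous (f : T -> R) :
  continuous f -> continuous (fun t => `|f t|).
Proof. by move=> cf t; apply: cvg_norm; exact: cf. Qed.

Lemma sum_continuous (I : Type) (r : seq I) (P : pred I) (f : I -> T -> R) :
  (forall i, continuous (f i)) -> continuous (fun t => \sum_(i <- r | P i) f i t).
Proof.
move=> cf; elim: r => [|i r ih].
  by under eq_fun do rewrite big_nil; exact: cst_continuous.
under eq_fun do rewrite big_cons.
by case: (P i) => //; exact: addf_continuous.
Qed.

Lemma prod_continuous (I : Type) (r : seq I) (P : pred I) (f : I -> T -> R) :
  (forall i, continuous (f i)) -> continuous (fun t => \prod_(i <- r | P i) f i t).
Proof.
move=> cf; elim: r => [|i r ih].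
  by under eq_fun do rewrite big_nil; exact: cst_continuous.
under eq_fun do rewrite big_cons.
by case: (P i) => //; exact: mulf_continuous.
Qed.

Lemma mx_continuous m n (f : T -> 'M[R]_(m, n)) :
  (forall i j, continuous (fun t => f t i j)) -> continuous f.
Proof.
move=> cf t U [P Pf PU].
have : \forall s \near t, forall ij : 'I_m * 'I_n, P ij.1 ij.2 (f s ij.1 ij.2).
  by apply: filter_forall => -[i j]; exact: (cf i j t _ (Pf i j)).
by apply: filterS => s Ps; apply: PU => i j; exact: (Ps (i, j)).
Qed.

Lemma coordf_continuous m n (f : T -> 'M[R]_(m, n)) i j :
  continuous f -> continuous (fun t => f t i j).
Proof.
by move=> cf t; exact: (continuous_comp (cf t) (@coord_continuous _ _ _ i j _)).
Qed.

Lemma addmx_continuous m n (f g : T -> 'M[R]_(m, n)) :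
  continuous f -> continuous g -> continuous (fun t => f t + g t).
Proof. by move=> cf cg t; apply: continuousD; [exact: cf|exact: cg]. Qed.

Lemma oppmx_continuous m n (f : T -> 'M[R]_(m, n)) :
  continuous f -> continuous (fun t => - f t).
Proof. by move=> cf t; apply: continuousN; exact: cf. Qed.

Lemma scalemx_continuous m n (c : T -> R) (f : T -> 'M[R]_(m, n)) :
  continuous c -> continuous f -> continuous (fun t => c t *: f t).
Proof.
move=> cc cf; apply: mx_continuous => i j.
under eq_fun do rewrite mxE.
by apply: mulf_continuous => //; exact: coordf_continuous.
Qed.

Lemma mulmx_continuous m n p (f : T -> 'M[R]_(m, n)) (g : T -> 'M[R]_(n, p)) :
  continuous f -> continuous g -> continuous (fun t => f t *m g t).
Proof.
move=> cf cg; apply: mx_continuous => i j.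
under eq_fun do rewrite mxE.
by apply: sum_continuous => k; apply: mulf_continuous; exact: coordf_continuous.
Qed.

Lemma compact_min (f : T -> R) (A : set T) :
  A !=set0 -> compact A -> continuous f ->
  exists2 c, A c & forall t, A t -> f c <= f t.
Proof.
move=> A0 cA cf.
have [c /[!inE] cinA cmin] := compact_EVT_min A0 cA (continuous_subspaceT cf).
by exists c => // t tA; apply: cmin; rewrite inE.
Qed.

Lemma compact_max (f : T -> R) (A : set T) :
  A !=set0 -> compact A -> continuous f ->
  exists2 c, A c & forall t, A t -> f t <= f c.
Proof.
move=> A0 cA cf.
have [c /[!inE] cinA cmax] := compact_EVT_max A0 cA (continuous_subspaceT cf).
by exists c => // t tA; apply: cmax; rewrite inE.
Qed.

Lemma closed_fun_le (f g : T -> R) : continuous f -> continuous g ->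
  closed [set t | f t <= g t].
Proof.
move=> cf cg;
  rewrite [X in closed X](_ : _ = (fun t => g t - f t) @^-1` [set y | 0 <= y]);
    last first.
  by apply/seteqP; split => t /=; rewrite subr_ge0.
apply: preimage_closed; last exact: closed_ge.
by move=> t _; apply: addf_continuous => //; exact: oppf_continuous.
Qed.

Lemma closed_fun_eq (f g : T -> R) : continuous f -> continuous g ->
  closed [set t | f t = g t].
Proof.
move=> cf cg;
  rewrite [X in closed X](_ : _ = [set t | f t <= g t] `&` [set t | g t <= f t]).
  by apply: closedI; exact: closed_fun_le.
apply/seteqP; split => t /= [].
  by move->; rewrite lexx.
by move=> fg gf; apply/eqP; rewrite eq_le fg gf.
Qed.

Lemma closed_forall (I : Type) (P : I -> T -> Prop) :
  (forall i, closed [set t | P i t]) -> closed [set t | forall i, P i t].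
Proof.
move=> cP; rewrite [X in closed X](_ : _ = \bigcap_(i in setT) [set t | P i t]).
  by apply: closed_bigI => i _; exact: cP.
by apply/seteqP; split => t Pt i; [move=> _; exact: Pt|exact: (Pt i)].
Qed.

End Continuity.

(** The two comparisons with the sup norm stand in for definiteness; they yield continuity and
    compactness of closed bounded sets directly. *)
Record vector_norm (R : realType) (n : nat) (N : 'rV[R]_n -> R) : Prop := {
  vnormD : forall x y, N (x + y) <= N x + N y ;
  vnormZ : forall c x, N (c *: x) = `|c| * N x ;
  vnorm_lb : exists2 c, 0 < c & forall x, c * `|x| <= N x ;
  vnorm_ub : exists2 c, 0 < c & forall x, N x <= c * `|x| }.

Section VectorNorm.
Variables (R : realType) (n : nat) (N : 'rV[R]_n -> R).
Hypothesis NN : vector_norm N.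
Implicit Types x y : 'rV[R]_n.

Lemma vnorm0 : N 0 = 0.
Proof. by rewrite -(scale0r 0) (vnormZ NN) normr0 mul0r. Qed.

Lemma vnormN x : N (- x) = N x.
Proof. by rewrite -scaleN1r (vnormZ NN) normrN1 mul1r. Qed.

Lemma vnorm_ge0 x : 0 <= N x.
Proof.
have [c c0 cN] := vnorm_lb NN.
by apply: le_trans (cN x); rewrite mulr_ge0// ltW.
Qed.

Lemma vnorm_gt0 x : x != 0 -> 0 < N x.
Proof.
move=> x0; have [c c0 cN] := vnorm_lb NN.
by apply: lt_le_trans (cN x); rewrite mulr_gt0// normr_gt0.
Qed.

Lemma vnorm_distC x y : N (x - y) = N (y - x).
Proof. by rewrite -opprB vnormN. Qed.

Lemma vnormB_ge x y : N x - N y <= N (x - y).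
Proof. by rewrite lerBlDr (le_trans _ (vnormD NN _ _))// subrK. Qed.

Lemma vnorm_dist x y : `|N x - N y| <= N (x - y).
Proof.
by rewrite ler_norml vnormB_ge andbT lerNl opprB vnorm_distC vnormB_ge.
Qed.

Lemma vnorm_continuous : continuous N.
Proof.
move=> x; have [c c0 Nc] := vnorm_ub NN.
apply/(@cvgrPdist_le _ _ _ (nbhs x)) => e e0.
apply/nbhs_ballP; exists (e / c); first by rewrite /= divr_gt0.
move=> y; rewrite -ball_normE /= => xy; rewrite (le_trans (vnorm_dist _ _))//
  (le_trans (Nc _))//.
by rewrite mulrC -ler_pdivlMr// ltW.
Qed.

Lemma vnorm_comp_continuous (T : topologicalType) (f : T -> 'rV[R]_n) :
  continuous f -> continuous (fun t => N (f t)).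
Proof. by move=> cf t; apply: continuous_comp;
  [exact: cf|exact: vnorm_continuous]. Qed.

Lemma vnorm_compact (A : set 'rV[R]_n) (M : R) :
  closed A -> (forall x, A x -> N x <= M) -> compact A.
Proof.
move=> cA AM; apply: bounded_closed_compact => //.
have [c c0 cN] := vnorm_lb NN.
exists (M / c); split; first exact: num_real.
move=> r Mr x Ax; apply: ltW; apply: le_lt_trans Mr.
by rewrite ler_pdivlMr// mulrC (le_trans (cN x))// AM.
Qed.

End VectorNorm.

Definition edot (R : realType) (n : nat) (x y : 'rV[R]_n) : R :=
  \sum_i x 0 i * y 0 i.

Section Dot.
Variables (R : realType) (n : nat).
Implicit Types x y z : 'rV[R]_n.

Lemma edotC x y : edot x y = edot y x.
Proof. by apply: eq_bigr => i _; rewrite mulrC. Qed.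

Lemma edotDl x y z : edot (x + y) z = edot x z + edot y z.
Proof. by rewrite /edot -big_split; apply: eq_bigr => i _;
  rewrite mxE mulrDl. Qed.

Lemma edotZl c x z : edot (c *: x) z = c * edot x z.
Proof. by rewrite /edot mulr_sumr; apply: eq_bigr => i _;
  rewrite mxE mulrA. Qed.

Lemma edotDr x y z : edot z (x + y) = edot z x + edot z y.
Proof. by rewrite edotC edotDl !(edotC z). Qed.

Lemma edotZr c x z : edot z (c *: x) = c * edot z x.
Proof. by rewrite edotC edotZl edotC. Qed.

Lemma edotNl x y : edot (- x) y = - edot x y.
Proof. by rewrite -scaleN1r edotZl mulN1r. Qed.

Lemma edotNr x y : edot x (- y) = - edot x y.
Proof. by rewrite edotC edotNl edotC. Qed.

Lemma edot_ge0 x : 0 <= edot x x.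
Proof. by apply: sumr_ge0 => i _; rewrite -expr2 sqr_ge0. Qed.

Lemma edot_gt0 x : x != 0 -> 0 < edot x x.
Proof.
move=> x0; rewrite lt0r edot_ge0 andbT; apply: contra x0 => /eqP d0.
apply/eqP/rowP => i; rewrite mxE; apply/eqP; rewrite -sqrf_eq0.
rewrite expr2; apply/eqP.
by apply: (psumr_eq0P _ d0) => // j _; rewrite -expr2 sqr_ge0.
Qed.

Lemma edot_continuous (T : topologicalType) (f g : T -> 'rV[R]_n) :
  continuous f -> continuous g -> continuous (fun t => edot (f t) (g t)).
Proof.
move=> cf cg; apply: sum_continuous => i.
by apply: mulf_continuous; exact: coordf_continuous.
Qed.

End Dot.

(** * Norm-one projections *)

Lemma convex_setP (R : realType) (n : nat) (A : set 'rV[R]_n) :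
  convex_set A <-> forall x y t, 0 <= t -> t <= 1 -> A x -> A y ->
    A (t *: x + (1 - t) *: y).
Proof.
split=> [cA x y t t0 t1 Ax Ay|cA x y l /[!inE] Ax Ay].
  have := cA x y (Itv01 t0 t1); rewrite !inE; exact.
by apply: (cA x y l%:num).
Qed.

Lemma submx_closed (R : realType) (k n : nat) (A : 'M[R]_(k, n)) :
  closed [set m : 'rV[R]_n | (m <= A)%MS].
Proof.
rewrite [X in closed X](_ : _ =
    [set m | forall j, (m *m cokermx A) 0 j = 0]); last first.
  apply/seteqP; split => m /=; rewrite submxE.
    by move=> /eqP -> j; rewrite mxE.
  by move=> m0; apply/eqP/rowP => j; rewrite m0 mxE.
apply: closed_forall => j; apply: closed_fun_eq; last exact: cst_continuous.
under eq_fun do rewrite mxE.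
apply: sum_continuous => i; apply: mulf_continuous; last exact: cst_continuous.
exact: coord_continuous.
Qed.

Section Contraction.
Variables (R : realType) (n : nat) (N : 'rV[R]_n -> R).
Hypothesis NN : vector_norm N.
Hypothesis NI : forall (P : {fset 'rV[R]_n}) (W : 'rV[R]_n -> R),
  P != fset0 -> prob_weights P W ->
  exists2 m, convex_hull [set` P] m &
    forall z, \sum_(p <- P) W p * N (m - p) <= \sum_(p <- P) W p * N (z - p).

Let pos (r : R) := (r + `|r|) / 2.

Let pos_ge0 r : 0 <= pos r.
Proof. by rewrite divr_ge0// -lerBlDl sub0r -normrN ler_norm. Qed.

Let pos_ge r : r <= pos r.
Proof. by rewrite ler_pdivlMr// mulr_natr mulr2n lerD2l ler_norm. Qed.

Let posM r : pos r * r = pos r ^+ 2.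
Proof.
rewrite /pos; have [r0|r0] := leP 0 r; first by rewrite ger0_norm//; field.
by rewrite ltr0_norm//; field.
Qed.

(** The squared positive part is C^1 with derivative [2 * pos g]; this is its expansion along a
    segment, with a quadratic remainder. The term [h ^+ 2] serves the case [g < 0], where
    [c <= t * h]. *)
Let pos_conv g h t : 0 <= t -> t <= 1 -> forall c, c <= (1 - t) * g + t * h ->
  pos c ^+ 2 <= pos g ^+ 2 + 2 * t * (pos g * (h - g)) + t ^+ 2 * ((h - g) ^+ 2 + h ^+ 2).
Proof.
move=> t0 t1 c cgh; have [c0|c0] := leP 0 c; last first.
  rewrite {1}/pos ltr0_norm// subrr mul0r expr0n/= mulrBr posM.
  set q := pos g ^+ 2; have q0 : 0 <= q by rewrite sqr_ge0.
  have [g0|g0] := leP 0 g.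
    rewrite /q /pos ger0_norm//.
    rewrite (_ : (g + g) / 2 = g); last by field.
    have := sqr_ge0 (g + t * (h - g)); have := sqr_ge0 (t * h).
    nra.
  rewrite /q/pos ltr0_norm// subrr !mul0r expr0n/= !subr0 mulr0 addr0 add0r.
  by rewrite mulr_ge0 ?addr_ge0 ?sqr_ge0.
rewrite {1}/pos ger0_norm// (_ : (c + c) / 2 = c); last by field.
have [g0|g0] := leP 0 g.
  rewrite /pos ger0_norm// (_ : (g + g) / 2 = g); last by field.
  have : c ^+ 2 <= (g + t * (h - g)) ^+ 2.
    by rewrite lerXn2r ?nnegrE//; lra.
  have := sqr_ge0 (t * h).
  by lra.
rewrite /pos ltr0_norm// subrr !mul0r expr0n/= add0r mulr0 add0r.
have : c ^+ 2 <= (t * h) ^+ 2 by rewrite lerXn2r ?nnegrE//; nra.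
have := sqr_ge0 (t * (h - g)).
by lra.
Qed.

(* At a minimizer [c] of the sum of the squared positive parts of
   [N (c - p) - N (z - p)], weighting [p] by the positive part makes the point
   supplied by [NI] a descent direction. *)
Lemma finite_contraction k (A : 'M[R]_(k, n)) (z : 'rV[R]_n)
    (P : {fset 'rV[R]_n}) : P != fset0 -> (forall p, p \in P -> (p <= A)%MS) ->
  exists2 m, (m <= A)%MS & forall p, p \in P -> N (m - p) <= N (z - p).
Proof.
move=> P0 PA; pose rho := \sum_(p <- P) N p.
have rhoP p : p \in P -> N p <= rho.
  move=> pP; rewrite /rho (big_fsetD1 p)//= lerDl.
  by apply: sumr_ge0 => q _; exact: vnorm_ge0.
(* A compact convex part of the subspace that contains [P], hence also the median supplied by
   [NI]. *)
pose D := [set m : 'rV[R]_n | (m <= A)%MS] `&` [set m | N m <= rho].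
have PD p : p \in P -> D p by move=> pP; split; [exact: PA|exact: rhoP].
have D_conv : convex_set D.
  apply/convex_setP => x y t t0 t1 [xA xr] [yA yr]; split.
    by rewrite /= addmx_sub// scalemx_sub.
  rewrite /= (le_trans (vnormD NN _ _))// !(vnormZ NN) !ger0_norm ?subr_ge0//.
  by move: xr yr => /= xr yr; nra.
have D_cpt : compact D.
  apply: (vnorm_compact NN (M := rho)); last by move=> x [].
  apply: closedI; first exact: submx_closed.
  by apply: closed_fun_le; [exact: vnorm_continuous|exact: cst_continuous].
have D0 : D !=set0 by have [p pP] := fset0Pn _ P0; exists p; exact: PD.
pose g m p := N (m - p) - N (z - p).
pose Phi m := \sum_(p <- P) pos (g m p) ^+ 2.
have cPhi : continuous Phi.
  apply: sum_continuous => p.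
  have cg : continuous (fun m => g m p).
    apply: addf_continuous; last exact: cst_continuous.
    apply: vnorm_comp_continuous => //; apply: addmx_continuous;
      first by move=> ?; exact: cvg_id.
    exact: cst_continuous.
  have cpos : continuous (fun m => pos (g m p)).
    apply: mulf_continuous; last exact: cst_continuous.
    by apply: addf_continuous => //; exact: normf_continuous.
  exact: mulf_continuous.
have [c [cA crho] cmin] := compact_min D0 D_cpt cPhi.
have Phi_ge0 : 0 <= Phi c by apply: sumr_ge0 => p _; exact: sqr_ge0.
have [Phi0|Phi_neq0] := eqVneq (Phi c) 0.
  exists c => // p pP; rewrite -subr_le0 (le_trans (pos_ge _))//.
  have : pos (g c p) ^+ 2 <= 0.
    rewrite -Phi0 /Phi (big_fsetD1 p)//= lerDl.
    by apply: sumr_ge0 => q _; exact: sqr_ge0.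
  have := pos_ge0 (g c p); set r := pos _; nra.
have {Phi_ge0}Phi_gt0 : 0 < Phi c by rewrite lt0r Phi_neq0.
pose S := \sum_(p <- P) pos (g c p).
have S_gt0 : 0 < S.
  rewrite lt0r sumr_ge0 ?andbT//; apply: contra Phi_neq0 => /eqP S0.
  rewrite /Phi big_seq big1// => p pP.
  have : pos (g c p) <= S.
    rewrite /S (big_fsetD1 p)//= lerDl.
    by apply: sumr_ge0 => q _; exact: pos_ge0.
  by rewrite S0; have := pos_ge0 (g c p); set r := pos _; nra.
pose W p := pos (g c p) / S.
have PW : prob_weights P W.
  split=> [p _|]; first by rewrite divr_ge0// ltW.
  by rewrite -mulr_suml divff// gt_eqF.
have [m mP /(_ z)] := NI P0 PW.
have {mP}[mA mrho] : D m.
  by move: m mP; apply: smallest_sub => // p pP; exact: PD.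
rewrite -subr_ge0 -sumrB => mz.
have {}mz : \sum_(p <- P) pos (g c p) * g m p <= 0.
  have -> : \sum_(p <- P) pos (g c p) * g m p =
      - (S * \sum_(p <- P) (W p * N (z - p) - W p * N (m - p))).
    rewrite mulr_sumr -sumrN; apply: eq_bigr => p _.
    rewrite /W /g; field.
    by rewrite gt_eqF.
  by rewrite oppr_le0 mulr_ge0// ltW.
pose K := \sum_(p <- P) ((g m p - g c p) ^+ 2 + g m p ^+ 2).
have K0 : 0 <= K by apply: sumr_ge0 => p _; rewrite addr_ge0 ?sqr_ge0.
(* Moving from [c] towards [m] by [t] changes [Phi] by at most [- 2 * t * Phi c + t ^+ 2 * K], which
   is negative for this [t]. *)
pose t := Phi c / (K + Phi c).
have KP : 0 < K + Phi c by lra.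
have t0 : 0 < t by rewrite divr_gt0.
have t1 : t <= 1 by rewrite ler_pdivrMr// mul1r; lra.
have : Phi c <= Phi (t *: m + (1 - t) *: c).
  apply: cmin; have /convex_setP := D_conv; apply=> //; exact: ltW.
have : Phi (t *: m + (1 - t) *: c) <= Phi c +
    2 * t * (\sum_(p <- P) pos (g c p) * g m p - Phi c) + t ^+ 2 * K.
  rewrite /Phi /K -sumrB !mulr_sumr -!big_split/=; apply: ler_sum => p _.
  apply: le_trans (pos_conv (g := g c p) (h := g m p) (ltW t0) t1 _) _;
    last first.
    by rewrite mulrBr posM.
  rewrite /g.
  have -> : t *: m + (1 - t) *: c - p = (1 - t) *: (c - p) + t *: (m - p).
    by rewrite !scalerBr addrACA -opprD -scalerDl subrK scale1r [_ + t *: m]addrC.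
  rewrite -lerBrDr opprK -!addrA (le_trans (vnormD NN _ _))// !(vnormZ NN).
  rewrite !ger0_norm ?subr_ge0//; last exact: ltW.
  by lra.
have tK : t * (K + Phi c) = Phi c by rewrite mulfVK// gt_eqF.
set Z := \sum_(p <- P) _ in mz *.
by nra.
Qed.

(** Passes from finite sets to the whole subspace by the finite intersection property. Adjoining 0
    to each finite set keeps its contraction points in the fixed compact set [C]. *)
Lemma subspace_contraction k (A : 'M[R]_(k, n)) (z : 'rV[R]_n) :
  exists2 m, (m <= A)%MS & forall p, (p <= A)%MS -> N (m - p) <= N (z - p).
Proof.
pose C := [set m : 'rV[R]_n | (m <= A)%MS] `&` [set m | N m <= N z].
have C_cpt : compact C.
  apply: (vnorm_compact NN (M := N z)); last by move=> x [].
  apply: closedI; first exact: submx_closed.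
  by apply: closed_fun_le; [exact: vnorm_continuous|exact: cst_continuous].
pose f p := C `&` [set m | N (m - p) <= N (z - p)].
have := C_cpt; rewrite compact_In0 => /(_ _ [set p | (p <= A)%MS] f).
case.
- exists (fun p => [set m | N (m - p) <= N (z - p)]) => // p _.
  apply: closed_fun_le; last exact: cst_continuous.
  apply: vnorm_comp_continuous => //; apply: addmx_continuous;
    first by move=> ?; exact: cvg_id.
  exact: cst_continuous.
- move=> P PA.
  have [||m mA mP] := @finite_contraction _ A z (0 |` P)%fset.
  + by apply/fset0Pn; exists 0; rewrite !inE eqxx.
  + move=> p; rewrite !inE => /orP[/eqP->|/PA]; first exact: sub0mx.
    by rewrite inE.
  exists m => p /= pP; split; last by apply: mP; rewrite !inE pP orbT.
  split=> //=; have := mP 0; rewrite !subr0; apply.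
  by rewrite !inE eqxx.
- move=> m mf; have [[mA _] _] := mf 0 (sub0mx _ _).
  by exists m => // p pA; have [_] := mf p pA.
Qed.

End Contraction.

(** * Smooth points *)

Lemma normr_rV_le (R : realType) (n : nat) (x : 'rV[R]_n) (M : R) :
  0 <= M -> (forall i, `|x 0 i| <= M) -> `|x| <= M.
Proof.
move=> M0 xM; rewrite /Num.norm/= mx_normrE; apply: bigmax_le => // -[i j] _ /=.
by rewrite ord1.
Qed.

Lemma sub_colmxP (R : fieldType) (n : nat) (x y m : 'rV[R]_n) :
  reflect (exists a b, m = a *: x + b *: y) (m <= col_mx x y)%MS.
Proof.
rewrite -addsmxE; apply: (iffP sub_addsmxP) => [[[u v] /= ->]|[a [b ->]]].
  by exists (u 0 0), (v 0 0);
    rewrite [u]mx11_scalar [v]mx11_scalar !mul_scalar_mx !mxE !eqxx !mulr1n.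
by exists (a%:M, b%:M); rewrite /= !mul_scalar_mx.
Qed.

(** [f] represents the unique supporting functional of the unit ball at [x]. Uniqueness is expressed
    through directions: a line through [x] that misses the open unit ball is parallel to the kernel
    of [f]. *)
Definition smooth_at (R : realType) (n : nat) (N : 'rV[R]_n -> R) (x f : 'rV[R]_n) :=
  [/\ N x = 1, edot f x = 1 &
    forall u, (forall t, 1 <= N (x + t *: u)) -> edot f u = 0].

Section Smooth.
Variables (R : realType) (n : nat) (N : 'rV[R]_n -> R).
Hypothesis NN : vector_norm N.
Implicit Types x y f : 'rV[R]_n.

Lemma edot_compact (A : set 'rV[R]_n) (y : 'rV[R]_n) (r : R) :
  closed A -> (forall v, A v -> edot (v - y) (v - y) <= r) -> compact A.
Proof.
move=> cA Ar; have [c c0 Nc] := vnorm_ub NN.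
apply: (vnorm_compact NN (M := N y + c * (1 + `|r|))) => // v Av.
rewrite -[v in N v](subrK y) addrC (le_trans (vnormD NN _ _))// lerD2l.
rewrite (le_trans (Nc _))// ler_pM2l//; apply: normr_rV_le => [|i].
  by rewrite addr_ge0.
have : `|(v - y) 0 i| ^+ 2 <= `|r|.
  rewrite (le_trans _ (ler_norm _))// (le_trans _ (Ar _ Av))//.
  rewrite real_normK ?num_real// /edot (bigD1 i)//= -expr2 lerDl.
  by apply: sumr_ge0 => j _; rewrite -expr2 sqr_ge0.
have : 0 <= `|(v - y) 0 i| by [].
set q := `|_|; set s := `|_|; nra.
Qed.

(* [x] is the point of [{v | 1 <= N v}] nearest to [(1 - d) *: y] for the
   Euclidean distance: the unit ball of [N] contains a Euclidean ball touching
   the unit sphere at [x], hence has a single tangent hyperplane there. *)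
Lemma smooth_near (y : 'rV[R]_n) (d : R) : N y = 1 -> 0 < d -> d < 1 ->
  exists x f, smooth_at N x f /\
    edot (x - y) (x - y) <= 4 * d ^+ 2 * edot y y.
Proof.
move=> Ny d0 d1; pose y' := (1 - d) *: y.
have Ny' : N y' = 1 - d by rewrite (vnormZ NN) Ny mulr1 ger0_norm//
  subr_ge0 ltW.
pose e v := edot (v - y') (v - y').
have e_cont : continuous e.
  by apply: edot_continuous; apply: addmx_continuous;
    [move=> ?; exact: cvg_id|exact: cst_continuous
    |move=> ?; exact: cvg_id|exact: cst_continuous].
pose A := [set v : 'rV[R]_n | 1 <= N v] `&` [set v | e v <= e y].
have A_cpt : compact A.
  apply: (@edot_compact _ y' (e y)); last by move=> v [].
  apply: closedI; apply: closed_fun_le => //; try exact: cst_continuous.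
  exact: vnorm_continuous.
have A0 : A !=set0 by exists y; split=> /=; rewrite ?Ny.
have [x [/= Nx exy] xmin] := compact_min A0 A_cpt e_cont.
have {}xmin v : 1 <= N v -> e x <= e v.
  move=> Nv; have [vy|/ltW yv] := leP (e v) (e y); first exact: xmin.
  exact: le_trans yv.
have pert u t : e (x + t *: u) = e x + 2 * t * edot (x - y') u + t ^+ 2 * edot u u.
  rewrite /e addrAC; move: (x - y') => w.
  rewrite !(edotDl, edotDr, edotZl, edotZr) (edotC u); ring.
have xy' : x - y' != 0.
  by rewrite subr_eq0; apply: contraTneq Nx => ->; rewrite Ny' -ltNge; lra.
have ex0 : 0 < e x by exact: edot_gt0.
have eta0 : 0 < N (x - y') by exact: vnorm_gt0.
have {}Nx : N x = 1.
  apply/eqP; rewrite eq_le Nx andbT leNgt; apply/negP => Nx1.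
  (* For this [t], [N x - t * N (x - y') = 1 + t * N x], so [x] can move towards [y'] without
     entering the open unit ball. *)
  pose t := (N x - 1) / (N (x - y') + N x).
  have D0 : 0 < N (x - y') + N x by lra.
  have tE : t * (N (x - y') + N x) = N x - 1 by rewrite mulfVK ?gt_eqF.
  have t0 : 0 < t by rewrite divr_gt0//; lra.
  have t1 : t < 1 by rewrite ltr_pdivrMr//; lra.
  have /xmin : 1 <= N (x + (- t) *: (x - y')).
    have := vnormB_ge NN x (t *: (x - y')); rewrite (vnormZ NN) gtr0_norm//
      scaleNr.
    nra.
  rewrite pert -/(e x).
  have : 0 < e x * (t * (2 - t)) by apply: mulr_gt0 => //;
    apply: mulr_gt0 => //; lra.
  lra.
pose g u := edot (x - y') u.
have gx : 0 < g x.
  rewrite ltNge; apply/negP => gx.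
  (* For [t >= 0] the triangle inequality keeps [x + t *: u] outside the open unit ball, although
     [g u < 0] brings it closer to [y'] for small [t]. *)
  pose eta := N (x - y'); pose u := eta *: x - (x - y').
  have gu : g u < 0.
    by rewrite /g edotDr edotZr edotNr -/(e x) -/(g x) /eta; nra.
  have D0 := edot_ge0 u.
  (* With this step length the first-order gain [2 * t ^+ 2 * (edot u u + 1)] exceeds the
     second-order loss [t ^+ 2 * edot u u]. *)
  pose t := - g u / (edot u u + 1).
  have tE : t * (edot u u + 1) = - g u by rewrite mulfVK// gt_eqF//; lra.
  have t0 : 0 < t by rewrite divr_gt0//; lra.
  have /xmin : 1 <= N (x + t *: u).
    have -> : x + t *: u = (1 + t * eta) *: x - t *: (x - y').
      by rewrite /u scalerBr scalerA scalerDl scale1r addrA.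
    have := vnormB_ge NN ((1 + t * eta) *: x) (t *: (x - y')).
    rewrite !(vnormZ NN) Nx (gtr0_norm t0) gtr0_norm -/eta; first by lra.
    by rewrite ltr_pwDl// mulr_ge0// ltW.
  rewrite pert -/(g u); nra.
exists x, ((g x)^-1 *: (x - y')); split; [split => //|].
- by rewrite edotZl mulVf// gt_eqF.
- move=> u xu; rewrite edotZl -/(g u).
  have D0 := edot_ge0 u.
  pose t := - g u / (edot u u + 1).
  have tE : t * (edot u u + 1) = - g u by rewrite mulfVK// gt_eqF//; lra.
  have := xmin _ (xu t); rewrite pert -/(g u) => h.
  suff -> : g u = 0 by rewrite mulr0.
  apply/eqP; rewrite -sqrf_eq0 eq_le sqr_ge0 andbT.
  have t2 : t ^+ 2 * (edot u u + 2) <= 0 by nra.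
  have tt : t ^+ 2 = 0 by have := sqr_ge0 t; nra.
  have : t == 0 by rewrite -sqrf_eq0 tt.
  by move=> /eqP t0; rewrite -sqrrN -tE t0 mul0r expr0n.
(* Both summands have squared length at most [d ^+ 2 * edot y y]; the parallelogram law gives the
   factor 4. *)
- rewrite (_ : x - y = (x - y') + (y' - y)); last by rewrite addrA subrK.
  have yy : edot (y' - y) (y' - y) = d ^+ 2 * edot y y.
    have -> : y' - y = (- d) *: y by rewrite /y' scalerBl scale1r addrAC subrr add0r scaleNr.
    by rewrite edotZl edotZr; ring.
  have eyE : e y = d ^+ 2 * edot y y.
    by rewrite -yy /e -opprB edotNl edotNr opprK.
  have := edot_ge0 (x - y' - (y' - y)).
  move: exy; rewrite eyE /e.
  move: (x - y') (y' - y) yy => v w yy vle.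
  rewrite !(edotDl, edotDr, edotNl, edotNr) (edotC w v) yy; lra.
Qed.

End Smooth.

(** * Reflections *)

Lemma segment_neq0 (R : fieldType) (n : nat) (w b : 'rV[R]_n) :
  w != 0 -> (forall r, b != r *: w) -> forall r, w + r *: (b - w) != 0.
Proof.
move=> w0 bw r; have [->|r0] := eqVneq r 0; first by rewrite scale0r addr0.
apply/negP => /eqP H; have /negP := bw (1 - r^-1); apply.
apply/eqP/rowP => i; move/rowP/(_ i): H; rewrite !mxE => H.
apply: (mulfI r0); rewrite mulrA mulrBr mulr1 divff//.
by apply/eqP; rewrite -subr_eq0 -H; apply/eqP; ring.
Qed.

Section Reflection.
Variables (R : realType) (n : nat) (N : 'rV[R]_n -> R).
Hypothesis NN : vector_norm N.
Hypothesis NC : forall k (A : 'M[R]_(k, n)) (z : 'rV[R]_n),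
  exists2 m, (m <= A)%MS & forall p, (p <= A)%MS -> N (m - p) <= N (z - p).
Implicit Types x y f : 'rV[R]_n.

(** Contract [d] onto a point of the plane of [x] and [e]. By homogeneity the difference supports
    [N] at every point of that plane, in particular at [x]; smoothness then puts it in the kernel of
    [f], so the point is a multiple of [e]. *)
Lemma contraction_direction x f e d : smooth_at N x f ->
  edot f e = 0 -> edot f d = 0 ->
  exists2 b, `|b| * N e <= N d &
    forall s r t, N (s *: x + r *: e) <= N (s *: x + r *: e + t *: (d - b *: e)).
Proof.
move=> [Nx fx xf] fe fd.
have [m /sub_colmxP[a [b mE]] mP] := NC (col_mx x e) d.
have {}mP s r t : N (s *: x + r *: e) <= N (s *: x + r *: e + t *: (d - m)).
  have [->|t0] := eqVneq t 0; first by rewrite scale0r addr0.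
  have -> : s *: x + r *: e + t *: (d - m) =
      t *: (d - (m - t^-1 *: (s *: x + r *: e))).
    by apply/rowP => i; rewrite !mxE; field.
  have {1}-> : s *: x + r *: e = t *: (m - (m - t^-1 *: (s *: x + r *: e))).
    by apply/rowP => i; rewrite !mxE; field.
  rewrite !(vnormZ NN) ler_wpM2l//; apply: mP; apply/sub_colmxP.
  exists (a - t^-1 * s), (b - t^-1 * r).
  by rewrite mE !scalerBl !scalerDr !scalerA opprD addrACA.
have a0 : a = 0.
  have /xf : forall t, 1 <= N (x + t *: (d - m)).
    by move=> t; have := mP 1 0 t; rewrite scale1r scale0r addr0 Nx.
  rewrite mE edotDr edotNr edotDr !edotZr fe fd fx mulr0 mulr1 addr0 add0r.
  by move/eqP; rewrite oppr_eq0 => /eqP.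
have {}mE : m = b *: e by rewrite mE a0 scale0r add0r.
rewrite mE in mP; exists b => //.
by have := mP 0 b 1; rewrite scale0r add0r scale1r addrC subrK (vnormZ NN).
Qed.

(* Along the segment from [a] to [b], the value [N (s *: x + .)] at the
   normalized point drops by only O(1/k) over k steps, because the common direction
   [d - bet *: e] supports both norms and the first-order losses telescope. *)
Lemma slice_mono x f a b s : smooth_at N x f -> edot f a = 0 -> edot f b = 0 ->
  N a = 1 -> N b = 1 -> (forall t, a + t *: (b - a) != 0) ->
  N (s *: x + a) <= N (s *: x + b).
Proof.
move=> xf fa fb Na Nb ab0; pose d := b - a; pose e t := a + t *: d.
(* The segment avoids 0, so [N] is bounded below on it; this bounds the coefficients [bet] uniformly
   by [B]. *)
have [p0 p00 p0P] : exists2 p0, 0 < p0 &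
    forall t, 0 <= t -> t <= 1 -> p0 <= N (e t).
  have cNe : continuous (fun t : R => N (e t)).
    apply: vnorm_comp_continuous => //; apply: addmx_continuous.
      exact: cst_continuous.
    apply: scalemx_continuous; first by move=> ?; exact: cvg_id.
    exact: cst_continuous.
  have I0 : (`[0, 1]%classic : set R) !=set0 by exists 0;
    rewrite /= in_itv/= lexx ler01.
  have [c _ cmin] := compact_min I0 (@segment_compact _ 0 1) cNe.
  exists (N (e c)); first exact/vnorm_gt0/ab0.
  by move=> t t0 t1; apply: cmin; rewrite /= in_itv/= t0.
have fd : edot f d = 0 by rewrite edotDr edotNr fa fb subrr.
have fe t : edot f (e t) = 0 by rewrite edotDr edotZr fd fa mulr0 addr0.
pose B := N d / p0.
have B0 : 0 <= B by apply: divr_ge0; [exact: vnorm_ge0|exact: ltW].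
have /choice[bet betP] t : exists b, (0 <= t -> t <= 1 -> `|b| <= B) /\
    forall s r t', N (s *: x + r *: e t) <= N (s *: x + r *: e t + t' *: (d - b *: e t)).
  have [c cd cP] := contraction_direction xf (fe t) fd.
  exists c; split=> // t0 t1; rewrite ler_pdivlMr//.
  by apply: le_trans cd; rewrite ler_wpM2l// p0P.
have bet_le t : 0 <= t -> t <= 1 -> `|bet t| <= B by have [] := betP t.
have {}betP t := (betP t).2.
pose G t := N (s *: x + (N (e t))^-1 *: e t).
have Gstep t h : 0 <= t -> 0 <= h -> t + h <= 1 -> h * B <= 1 ->
    G t - (h * (bet (t + h) - bet t) + h ^+ 2 * B ^+ 2) <= G (t + h).
  move=> t0 h0 th1 hB.
  have t1 : t <= 1 by lra.
  have th0 : 0 <= t + h by lra.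
  (* [e (t + h)] is written with the supporting direction at [t], and [e t] with the one at [t + h];
     this compares [p] and [q] in both directions. *)
  have eh : e (t + h) = (1 + h * bet t) *: e t + h *: (d - bet t *: e t).
    by apply/rowP => i; rewrite !mxE; ring.
  have eh' : e t = (1 - h * bet (t + h)) *: e (t + h) + (- h) *: (d - bet (t + h) *: e (t + h)).
    by apply/rowP => i; rewrite !mxE; ring.
  set p := N (e t); set q := N (e (t + h)).
  have p_gt0 : 0 < p := lt_le_trans p00 (p0P _ t0 t1).
  have q_gt0 : 0 < q := lt_le_trans p00 (p0P _ th0 th1).
  have /ler_normlP[b1 b2] := bet_le _ t0 t1.
  have /ler_normlP[b1' b2'] := bet_le _ th0 th1.
  set b1t := bet t in eh b1 b2 *; set b2t := bet (t + h) in eh' b1' b2' *.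
  have r0 : 0 <= 1 + h * b1t by nra.
  have r0' : 0 <= 1 - h * b2t by nra.
  have q_ge : (1 + h * b1t) * p <= q.
    have := betP t 0 (1 + h * b1t) h.
    by rewrite scale0r add0r -eh (vnormZ NN) ger0_norm.
  have p_ge : (1 - h * b2t) * q <= p.
    have := betP (t + h) 0 (1 - h * b2t) (- h).
    by rewrite scale0r add0r -eh' (vnormZ NN) ger0_norm.
  have G1 : N (s *: x + (q^-1 * (1 + h * b1t)) *: e t) <= G (t + h).
    have := betP t s (q^-1 * (1 + h * b1t)) (q^-1 * h).
    by rewrite -addrA -!(scalerA q^-1) -scalerDr -eh.
  apply: le_trans G1.
  (* Changing the coefficient of [e t] costs [1 - (1 + h * b1t) * (p / q)], which [p_ge] bounds by
     [h * (b2t - b1t) + h ^+ 2 * B ^+ 2]. *)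
  have -> : s *: x + (q^-1 * (1 + h * b1t)) *: e t =
     (s *: x + p^-1 *: e t) - (p^-1 - q^-1 * (1 + h * b1t)) *: e t.
    by apply/rowP => i; rewrite !mxE; ring.
  apply: le_trans (vnormB_ge NN _ _); rewrite lerD2l lerN2 (vnormZ NN) -/p.
  have qv : q^-1 * (1 + h * b1t) <= p^-1.
    by rewrite mulrC ler_pdivrMr// [leRHS]mulrC ler_pdivlMr.
  rewrite ger0_norm ?subr_ge0// mulrBl mulVf ?gt_eqF//.
  have : (1 + h * b1t) * (1 - h * b2t) <= (1 + h * b1t) * (p / q).
    by rewrite ler_wpM2l// ler_pdivlMr.
  have : b1t * b2t <= B ^+ 2 by nra.
  have : 0 <= h ^+ 2 by rewrite sqr_ge0.
  have -> : q^-1 * (1 + h * b1t) * p = (1 + h * b1t) * (p / q) by field;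
    rewrite gt_eqF.
  set z := (1 + h * b1t) * (p / q); set hh := h ^+ 2 => hh0 bb zz.
  have : hh * (b1t * b2t) <= hh * B ^+ 2 by rewrite ler_wpM2l.
  rewrite /hh; lra.
(* With step [h = 1 / k.+1] the terms in [bet] telescope to at most [2 * B * h], and the [k.+1]
   quadratic terms add up to [h * B ^+ 2]. *)
have Gk k : B <= k.+1%:R -> G 0 - (2 * B + B ^+ 2) / k.+1%:R <= G 1.
  move=> Bk; pose h : R := k.+1%:R^-1.
  have k0 : 0 < k.+1%:R :> R by rewrite ltr0n.
  have h0 : 0 <= h by rewrite invr_ge0 ltW.
  have hk : h * k.+1%:R = 1 by rewrite mulVf// gt_eqF.
  have hB : h * B <= 1 by rewrite mulrC ler_pdivrMr// mul1r.
  have Gi i : (i <= k.+1)%N ->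
      G 0 - (h * (bet (h * i%:R) - bet 0) + i%:R * (h ^+ 2 * B ^+ 2)) <= G (h * i%:R).
    elim: i => [|i ih] ik; first by rewrite mulr0 subrr mulr0 mul0r addr0 subr0.
    have i1 : h * i%:R + h <= 1.
      have -> : h * i%:R + h = h * i.+1%:R by rewrite -natr1 mulrDr mulr1.
      by rewrite -[leRHS]hk ler_wpM2l// ler_nat.
    have i0 : 0 <= h * i%:R by rewrite mulr_ge0.
    have := Gstep _ _ i0 h0 i1 hB; have := ih (ltnW ik).
    have -> : h * i.+1%:R = h * i%:R + h by rewrite -natr1 mulrDr mulr1.
    rewrite -natr1; lra.
  have := Gi k.+1 (leqnn _); rewrite hk.
  have /ler_normlP[b1 b2] := bet_le _ (lexx 0) ler01.
  have /ler_normlP[b1' b2'] := bet_le _ ler01 (lexx 1).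
  have -> : k.+1%:R * (h ^+ 2 * B ^+ 2) = h * B ^+ 2.
    by rewrite mulrA expr2 mulrA [k.+1%:R * h]mulrC hk mul1r.
  have : h * (bet 1 - bet 0) <= h * (2 * B) by rewrite ler_wpM2l//; lra.
  rewrite -/h mulrC; lra.
have e0 : e 0 = a by rewrite /e scale0r addr0.
have e1 : e 1 = b by rewrite /e scale1r addrC subrK.
have G0E : G 0 = N (s *: x + a) by rewrite /G e0 Na invr1 scale1r.
have G1E : G 1 = N (s *: x + b) by rewrite /G e1 Nb invr1 scale1r.
rewrite -G0E -G1E leNgt; apply/negP => G10.
have D0 : 0 < G 0 - G 1 by rewrite subr_gt0.
pose C := 2 * B + B ^+ 2; have C0 : 0 <= C by rewrite addr_ge0 ?sqr_ge0//
  mulr_ge0.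
have [k kP] : exists k : nat, B + C / (G 0 - G 1) < k.+1%:R.
  by exists (Num.trunc (B + C / (G 0 - G 1))); rewrite truncnS_gt.
have CD : 0 <= C / (G 0 - G 1) by rewrite divr_ge0// ltW.
have Bk : B <= k.+1%:R by rewrite (le_trans _ (ltW kP))// lerDl.
have : C / k.+1%:R < G 0 - G 1.
  rewrite ltr_pdivrMr ?ltr0n// mulrC -ltr_pdivrMr//.
  by rewrite (le_lt_trans _ kP)// lerDr.
have := Gk k Bk; rewrite -/C.
set u := C / _; move: (G 0) (G 1) => g0 g1; lra.
Qed.

(** Inside the kernel of [f] the segment from [a] to [- a] meets 0, so the path goes through a third
    vector [b], independent of [a]; this is where the dimension enters. [slice_mono] on both
    segments gives one inequality, and exchanging [m] with [- m] gives the other. *)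
Lemma smooth_reflection x f : (3 <= n)%N -> smooth_at N x f ->
  forall v, N ((2 * edot f v) *: x - v) = N v.
Proof.
move=> n3 xf; have [Nx fx _] := xf.
suff H s m : edot f m = 0 -> N (s *: x + m) <= N (s *: x - m).
  move=> v; pose m := v - edot f v *: x.
  have fm : edot f m = 0 by rewrite edotDr edotNr edotZr fx mulr1 subrr.
  have vE : v = edot f v *: x + m by rewrite addrC subrK.
  have -> : (2 * edot f v) *: x - v = edot f v *: x - m.
    by rewrite /m opprB addrA -scalerDl mulr_natl mulr2n.
  rewrite [in RHS]vE; apply/eqP; rewrite eq_le H// andbT.
  by have := H (edot f v) (- m); rewrite opprK; apply; rewrite edotNr fm oppr0.
move=> fm; have [->|m0] := eqVneq m 0; first by rewrite subr0 addr0.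
have [c cxm] : exists c : 'rV[R]_n, ~~ (c <= col_mx x m)%MS.
  apply: contrapT => H; move: n3; rewrite ltnNge => /negP; apply.
  rewrite -(mxrank1 R n) -[leqRHS]/(1 + 1)%N.
  apply: leq_trans (rank_leq_row (col_mx x m)); apply: mxrankS.
  by apply/row_subP => i; apply: contraT => nc; case: H; exists (row i 1%:M).
pose c' := c - edot f c *: x.
have fc' : edot f c' = 0 by rewrite edotDr edotNr edotZr fx mulr1 subrr.
have c'm t : c' != t *: m.
  apply: contra cxm => /eqP /(canRL (subrK _)) ->; apply/sub_colmxP.
  by exists (edot f c), t; rewrite addrC.
have c'0 : c' != 0 by rewrite -(scale0r m) c'm.
have Nm : 0 < N m by exact: vnorm_gt0.
have Nc : 0 < N c' by exact: vnorm_gt0.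
pose a := (N m)^-1 *: m; pose b := (N c')^-1 *: c'.
have Na : N a = 1 by rewrite (vnormZ NN) gtr0_norm ?invr_gt0// mulVf ?gt_eqF.
have Nb : N b = 1 by rewrite (vnormZ NN) gtr0_norm ?invr_gt0// mulVf ?gt_eqF.
have fa : edot f a = 0 by rewrite edotZr fm mulr0.
have fb : edot f b = 0 by rewrite edotZr fc' mulr0.
have ba t : b != t *: a.
  rewrite /a /b; apply/negP => /eqP /(congr1 (fun v => N c' *: v)).
  rewrite !scalerA divff ?gt_eqF// scale1r => /eqP; exact/negP/c'm.
have ab w t : w = a \/ w = - a -> w + t *: (b - w) != 0 /\ b + t *: (w - b) != 0.
  have a0 : a != 0 by apply: contra_eq_neq Na => ->;
    rewrite (vnorm0 NN) eq_sym oner_eq0.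
  move=> wa.
  have bw r : b != r *: w.
    by case: wa => ->; [exact: ba|rewrite scalerN -scaleNr; exact: ba].
  have w0 : w != 0 by case: wa => ->; rewrite ?oppr_eq0.
  have key r := segment_neq0 w0 bw r.
  split=> //.
  have -> : b + t *: (w - b) = w + (1 - t) *: (b - w); last exact: key.
  by move: (b) => b'; apply/rowP => i; rewrite !mxE; ring.
have Ha s' : N (s' *: x + a) <= N (s' *: x - a).
  apply: (@le_trans _ _ (N (s' *: x + b))).
    by apply: slice_mono xf fa fb Na Nb _ => t;
      have [] := ab a t (or_introl erefl).
  apply: slice_mono xf fb _ Nb _ _; rewrite ?edotNr ?fa ?oppr0 ?vnormN// => t.
  by have [] := ab (- a) t (or_intror erefl).
have -> : s *: x + m = N m *: ((s / N m) *: x + a).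
  by rewrite scalerDr !scalerA mulrCA divff ?gt_eqF// mulr1 scale1r.
have -> : s *: x - m = N m *: ((s / N m) *: x - a).
  by rewrite scalerBr !scalerA mulrCA divff ?gt_eqF// mulr1 scale1r.
by rewrite !(vnormZ NN) ler_wpM2l.
Qed.

End Reflection.

Lemma normr_le_edot (R : realType) (n : nat) (x : 'rV[R]_n) :
  `|x| ^+ 2 <= edot x x.
Proof.
rewrite -[leRHS]sqr_sqrtr ?edot_ge0// lerXn2r ?nnegrE ?sqrtr_ge0//.
apply: normr_rV_le => [|i]; first exact: sqrtr_ge0.
rewrite -sqrtr_sqr ler_wsqrtr// /edot (bigD1 i)//= -expr2 lerDl.
by apply: sumr_ge0 => j _; rewrite -expr2 sqr_ge0.
Qed.

(** Pairs of a unit vector and a reflection fixing it form a compact set [T], and smooth points are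
    dense; hence the pair of [T] nearest to the normalized [y] sits exactly over [y]. *)
Lemma all_reflection (R : realType) (n : nat) (N : 'rV[R]_n -> R) :
  vector_norm N ->
  (forall x f, smooth_at N x f ->
    forall v, N ((2 * edot f v) *: x - v) = N v) ->
  forall y, y != 0 -> exists2 f, edot f y = 1 &
    forall v, N ((2 * edot f v) *: y - v) = N v.
Proof.
move=> NN HR y0 y0_neq0; have Ny0 := vnorm_gt0 NN y0_neq0.
pose y := (N y0)^-1 *: y0.
have Ny : N y = 1 by rewrite (vnormZ NN) gtr0_norm ?invr_gt0// mulVf ?gt_eqF.
suff [f fy fP] : exists2 f, edot f y = 1 &
    forall v, N ((2 * edot f v) *: y - v) = N v.
  exists ((N y0)^-1 *: f); first by rewrite edotZl -edotZr.
  move=> v; rewrite edotZl -[RHS]fP; congr (N (_ - _)).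
  by rewrite /y scalerA; congr (_ *: _); ring.
have [c c0 Nc] := vnorm_ub NN.
pose T := [set p : 'rV[R]_n * 'rV[R]_n | N p.1 = 1] `&` ([set p | edot p.2 p.1 = 1] `&`
  [set p | forall v, N ((2 * edot p.2 v) *: p.1 - v) = N v]).
have c1 : continuous (fun p : 'rV[R]_n * 'rV[R]_n => p.1) by move=> p;
  exact: cvg_fst.
have c2 : continuous (fun p : 'rV[R]_n * 'rV[R]_n => p.2) by move=> p;
  exact: cvg_snd.
have T_cpt : compact T.
  have ball_cpt r : compact [set x | N x <= r].
    apply: (vnorm_compact NN (M := r)) => //.
    by apply: closed_fun_le; [exact: vnorm_continuous|exact: cst_continuous].
  apply: (@subclosed_compact _ _ ([set x | N x <= 1] `*` [set f | N f <= c ^+ 2])).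
  - apply: closedI.
      by apply: closed_fun_eq;
        [exact: vnorm_comp_continuous|exact: cst_continuous].
    apply: closedI.
      by apply: closed_fun_eq; [exact: edot_continuous|exact: cst_continuous].
    apply: closed_forall => v; apply: closed_fun_eq; last exact: cst_continuous.
    apply: vnorm_comp_continuous => //; apply: addmx_continuous;
      last exact: cst_continuous.
    apply: scalemx_continuous => //; apply: mulf_continuous;
      first exact: cst_continuous.
    by apply: edot_continuous => //; exact: cst_continuous.
  - exact: compact_setX.
  - move=> [x f] [/= Nx [fx xf]]; split=> /=; first by rewrite Nx.
    (* The reflection is applied to [f] itself: the triangle inequality bounds [2 * edot f f] by
       [2 * N f]. Comparison with the sup norm then gives [N f <= c ^+ 2]. *)
    have fv : edot f f <= N f.
      have := vnormD NN ((2 * edot f f) *: x - f) f.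
      rewrite subrK xf (vnormZ NN) Nx mulr1 ger0_norm; first lra.
      by rewrite mulr_ge0// edot_ge0.
    have := normr_le_edot f; have := Nc f; have := vnorm_ge0 NN f.
    have : 0 <= `|f| by [].
    set q := `|f| => q0 Nf0 Nfq qf.
    have : N f ^+ 2 <= c ^+ 2 * N f.
      apply: (@le_trans _ _ ((c * q) ^+ 2));
        first by rewrite lerXn2r ?nnegrE ?mulr_ge0// ltW.
      by rewrite exprMn ler_wpM2l ?sqr_ge0//; lra.
    have [->|Nf] := eqVneq (N f) 0; first by rewrite sqr_ge0.
    by rewrite expr2 ler_pM2r// lt0r Nf.
pose h (p : 'rV[R]_n * 'rV[R]_n) := edot (p.1 - y) (p.1 - y).
have ch : continuous h.
  by apply: edot_continuous; apply: addmx_continuous => //;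
    exact: cst_continuous.
have Tnear d : 0 < d -> d < 1 -> exists2 p, T p & h p <= 4 * d ^+ 2 * edot y y.
  move=> d0 d1; have [x [f [xf xy]]] := smooth_near NN Ny d0 d1.
  by exists (x, f) => //; have [] := xf; split=> //; split=> //=; exact: HR.
have T0 : T !=set0.
  have [||p Tp _] := Tnear 2^-1; last by exists p.
    by rewrite invr_gt0.
  by rewrite invf_lt1// ltr1n.
have [[x f] [/= _ [fx xf]] xmin] := compact_min T0 T_cpt ch.
suff xy : x = y by exists f; rewrite -xy.
apply/eqP; rewrite -subr_eq0; apply: contraT => /edot_gt0 h0.
pose H := edot (x - y) (x - y); pose Y := edot y y.
have Y0 : 0 <= Y by exact: edot_ge0.
have D0 : 0 < H + 4 * Y + 1 by rewrite /H; lra.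
(* Chosen so that [d < 1] and [4 * d ^+ 2 * Y < H], which contradicts the minimality of [H]. *)
pose d := H / (H + 4 * Y + 1).
have d0 : 0 < d by rewrite divr_gt0.
have d1 : d < 1 by rewrite ltr_pdivrMr// mul1r; lra.
have dE : d * (H + 4 * Y + 1) = H by rewrite mulfVK// gt_eqF.
have [p Tp hp] := Tnear d d0 d1.
have : H <= 4 * d ^+ 2 * Y by exact: le_trans (xmin _ Tp) hp.
have : 0 <= d * (1 - d) * Y.
  by apply: mulr_ge0 => //; apply: mulr_ge0; rewrite ?subr_ge0; exact: ltW.
have : 0 < d * H by rewrite mulr_gt0.
clearbody d H Y; lra.
Qed.

(** * Extremal quadratic forms in the plane *)

Section Quadratic.
Variables (R : realType) (M : R -> R -> R).
Hypothesis MZ : forall c s t, M (c * s) (c * t) = `|c| * M s t.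
Hypothesis M_lb : exists2 e, 0 < e &
  forall s t, e * (s ^+ 2 + t ^+ 2) <= M s t ^+ 2.
Hypothesis M_refl : forall s0 t0, (s0 != 0) || (t0 != 0) ->
  exists u v, s0 * u + t0 * v = 1 /\ forall s t,
    M (2 * (s * u + t * v) * s0 - s) (2 * (s * u + t * v) * t0 - t) = M s t.

(** Maximizing [disc] over [S] minimizes the area of the ellipse [q p <= 1] around the unit ball of
    [M]: the maximizer is its Loewner ellipse. The sign conditions in [S] exclude negative definite
    forms, on which [disc] is unbounded. *)
Let q (p : R * (R * R)) s t := p.1 * s ^+ 2 + 2 * p.2.1 * s * t + p.2.2 * t ^+ 2.
Let disc (p : R * (R * R)) := p.1 * p.2.2 - p.2.1 ^+ 2.
Let S : set (R * (R * R)) := [set p | 0 <= p.1] `&` ([set p | 0 <= p.2.2] `&`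
  [set p | forall s t, q p s t <= M s t ^+ 2]).

Let c1 : continuous (fun p : R * (R * R) => p.1).
Proof. by move=> p; exact: cvg_fst. Qed.

Let c2 : continuous (fun p : R * (R * R) => p.2.1).
Proof. by move=> p; apply: (@cvg_comp _ _ _ snd fst);
  [exact: cvg_snd|exact: cvg_fst]. Qed.

Let c3 : continuous (fun p : R * (R * R) => p.2.2).
Proof. by move=> p; apply: (@cvg_comp _ _ _ snd snd);
  [exact: cvg_snd|exact: cvg_snd]. Qed.

Let S_compact : compact S.
Proof.
apply: (@subclosed_compact _ _ (`[0, M 1 0 ^+ 2]%classic `*`
  (`[- M 1 (-1) ^+ 2, M 1 1 ^+ 2]%classic `*` `[0, M 0 1 ^+ 2]%classic))).
- apply: closedI; first by apply: closed_fun_le => //; exact: cst_continuous.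
  apply: closedI; first by apply: closed_fun_le => //; exact: cst_continuous.
  apply: closed_forall => s; apply: closed_forall => t.
  apply: closed_fun_le; last exact: cst_continuous.
  apply: addf_continuous; first apply: addf_continuous.
  + by apply: mulf_continuous => //; exact: cst_continuous.
  + apply: mulf_continuous; last exact: cst_continuous.
    apply: mulf_continuous; last exact: cst_continuous.
    by apply: mulf_continuous => //; exact: cst_continuous.
  + by apply: mulf_continuous => //; exact: cst_continuous.
- apply: compact_setX; first exact: segment_compact.
  by apply: compact_setX; exact: segment_compact.
- move=> [a [b c]] [/= a0 [c0 qM]].
  have := qM 1 0; have := qM 0 1; have := qM 1 1; have := qM 1 (-1).
  rewrite /q/= !in_itv/= a0 c0/= => h1 h2 h3 h4.
  have := sqr_ge0 (M 1 (-1)); have := sqr_ge0 (M 1 1).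
  by split; [lra|split; [apply/andP; split; lra|lra]].
Qed.

Let S_max : exists2 p, S p & 0 < disc p /\ forall p', S p' -> disc p' <= disc p.
Proof.
have [e e0 eM] := M_lb.
have Se : S (e, (0, e)).
  split; first exact: ltW.
  split; first exact: ltW.
  by move=> s t; apply: le_trans (eM s t); rewrite /q/=; lra.
have cdisc : continuous disc.
  apply: addf_continuous; first exact: mulf_continuous.
  apply: oppf_continuous.
  exact: mulf_continuous.
have [p Sp pmax] := compact_max (ex_intro _ _ Se) S_compact cdisc.
exists p => //; split=> //; apply: lt_le_trans (pmax _ Se).
by rewrite /disc/= expr0n/= subr0 mulr_gt0.
Qed.

(* [disc] is strictly log-concave on positive forms, so its maximizer on [S] is
   unique, hence invariant under the reflections. *)
Let max_unique p p' : S p -> S p' -> 0 < disc p -> disc p' = disc p ->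
  (forall p'', S p'' -> disc p'' <= disc p) -> p' = p.
Proof.
case: p => a [b c];
  case: p' => a' [b' c'] [/= a0 [c0 qM]] [/= a0' [c0' qM']] D0 DE Dmax.
have Sm : S ((a + a') / 2, ((b + b') / 2, (c + c') / 2)).
  split=> /=; first by lra.
  split=> /=; first by lra.
  by move=> s t; have := qM s t; have := qM' s t; rewrite /q/=; lra.
have := Dmax _ Sm; move: D0 DE; rewrite /disc/= => D0 DE Dm.
have ca : 0 < a by nra.
have ca' : 0 < a' by nra.
(* Maximality is tested at the midpoint of the two forms. Multiplying by [a * a'] and eliminating
   [c] and [c'] through the common discriminant turns this into the vanishing of a sum of
   squares. *)
have mid : a * c' + a' * c - 2 * b * b' <= 2 * (a * c - b ^+ 2) by nra.
have key : (a * c - b ^+ 2) * (a - a') ^+ 2 + (a * b' - a' * b) ^+ 2 <= 0.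
  have : a * a' * (a * c' + a' * c - 2 * b * b') <= a * a' * (2 * (a * c - b ^+ 2)).
    by rewrite ler_pM2l// mulr_gt0.
  have -> : a * a' * (a * c' + a' * c - 2 * b * b') =
    a ^+ 2 * (a' * c') + a' ^+ 2 * (a * c) - 2 * a * a' * b * b' by ring.
  have -> : a' * c' = a * c - b ^+ 2 + b' ^+ 2 by lra.
  lra.
have aa : a' = a.
  apply/eqP; rewrite eq_sym -subr_eq0 -sqrf_eq0 eq_le sqr_ge0 andbT.
  by have := sqr_ge0 (a * b' - a' * b); have := sqr_ge0 (a - a'); nra.
have bb : b' = b.
  apply/eqP; rewrite -subr_eq0 -(mulrI_eq0 _ (mulfI (lt0r_neq0 ca))) -sqrf_eq0.
  rewrite eq_le sqr_ge0 andbT; move: key; rewrite aa subrr expr0n/= mulr0 add0r.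
  by rewrite mulrBr.
congr (_, (_, _)) => //; apply: (mulfI (lt0r_neq0 ca)).
by move: DE; rewrite aa bb; lra.
Qed.

(** The Loewner form [Q] is invariant under the reflections of [M], and these carry any point of a
    level curve of [Q] to any other. So [M] is constant on the level curves, and homogeneity makes
    [M ^+ 2] a multiple of [Q]. *)
Lemma quadratic_of_reflections : exists a b c,
  forall s t, M s t ^+ 2 = a * s ^+ 2 + 2 * b * s * t + c * t ^+ 2.
Proof.
have [[a [b c]] Sp [D0 Dmax]] := S_max.
have [/= a0 [c0 qM]] := Sp.
pose Q s t := a * s ^+ 2 + 2 * b * s * t + c * t ^+ 2.
have D0' : 0 < a * c - b ^+ 2 by [].
have ca : 0 < a by nra.
have aQ s t : a * Q s t = (a * s + b * t) ^+ 2 + (a * c - b ^+ 2) * t ^+ 2.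
  by rewrite /Q; ring.
have Q_ge0 s t : 0 <= Q s t.
  by rewrite -(pmulr_rge0 _ ca) aQ addr_ge0 ?sqr_ge0// mulr_ge0 ?sqr_ge0// ltW.
have Q_gt0 s t : (s != 0) || (t != 0) -> 0 < Q s t.
  rewrite -(pmulr_rgt0 _ ca) aQ; have [->|t0] := eqVneq t 0.
    rewrite orbF => s0; rewrite mulr0 addr0 expr0n mulr0 addr0.
    by rewrite exprn_even_gt0//= mulf_neq0// gt_eqF.
  by move=> _; rewrite ltr_wpDl ?sqr_ge0// mulr_gt0// exprn_even_gt0.
(* A reflection has determinant -1, so composing with it preserves [disc] as well as [S]; uniqueness
   of the maximizer gives invariance. *)
have Qinv s0 t0 u v : s0 * u + t0 * v = 1 -> (forall s t,
    M (2 * (s * u + t * v) * s0 - s) (2 * (s * u + t * v) * t0 - t) = M s t) ->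
    forall s t,
    Q (2 * (s * u + t * v) * s0 - s) (2 * (s * u + t * v) * t0 - t) = Q s t.
  move=> suv Muv.
  pose A := 2 * u * s0 - 1; pose C := 2 * u * t0.
  pose B := 2 * v * s0; pose E := 2 * v * t0 - 1.
  have detR : A * E - B * C = -1.
    have -> : A * E - B * C = 1 - 2 * (s0 * u + t0 * v) by rewrite /A /B /C /E;
      ring.
    by rewrite suv; ring.
  pose p' := (Q A C, (a * A * B + b * (A * E + B * C) + c * C * E, Q B E)).
  have qp' s t : q p' s t = Q (2 * (s * u + t * v) * s0 - s) (2 * (s * u + t * v) * t0 - t).
    by rewrite /q /= /Q /A /B /C /E; ring.
  have Sp' : S p'.
    split; first exact: Q_ge0.
    split; first exact: Q_ge0.
    by move=> s t; rewrite qp' -Muv; exact: qM.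
  have : p' = (a, (b, c)).
    apply: max_unique => //.
    have -> : disc p' = (a * c - b ^+ 2) * (A * E - B * C) ^+ 2.
      by rewrite /disc /= /Q; ring.
    by rewrite detR sqrrN expr1n mulr1.
  by move=> p'E s t; rewrite -qp' p'E.
have QM s1 t1 s2 t2 : Q s1 t1 = Q s2 t2 -> M s1 t1 = M s2 t2.
  (* The reflection fixing the sum of the two points exchanges them; if the sum is 0 they are
     opposite. *)
  move=> QE; have [w0|] := boolP ((s1 + s2 != 0) || (t1 + t2 != 0)); last first.
    rewrite negb_or !negbK => /andP[/eqP s12 /eqP t12].
    have -> : s2 = -1 * s1 by lra.
    have -> : t2 = -1 * t1 by lra.
    by rewrite MZ normrN1 mul1r.
  have [u [v [suv Muv]]] := M_refl w0.
  have Qr := Qinv _ _ _ _ suv Muv.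
  have Qw := Q_gt0 _ _ w0.
  pose phi := s1 * u + t1 * v.
  (* [P] is the polar form of [Q] at the first point and the fixed vector. Invariance at that point
     and at its translate by the fixed vector gives [phi * Q w1 w2 = P], while [QE] gives
     [Q w1 w2 = 2 * P]. *)
  have phiE : phi = 1 / 2.
    set w1 := s1 + s2 in suv Qr Qw; set w2 := t1 + t2 in suv Qr Qw.
    pose P := a * s1 * w1 + b * (s1 * w2 + t1 * w1) + c * t1 * w2.
    have QP : Q w1 w2 = 2 * P.
      have : Q w1 w2 = 2 * P + (Q s2 t2 - Q s1 t1) by rewrite /P /Q /w1 /w2;
        ring.
      by rewrite QE subrr addr0.
    have e1 : phi * (phi * Q w1 w2 - P) = 0.
      have := Qr s1 t1; rewrite -/phi => h.
      have : Q (2 * phi * w1 - s1) (2 * phi * w2 - t1) - Q s1 t1 =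
         4 * (phi * (phi * Q w1 w2 - P)) by rewrite /P /Q; ring.
      by rewrite h subrr; lra.
    have e2 : (phi + 1) * (phi * Q w1 w2 - P) = 0.
      have := Qr (s1 + w1) (t1 + w2).
      have -> : (s1 + w1) * u + (t1 + w2) * v = phi + 1 by rewrite -suv /phi;
        ring.
      move=> h.
      have : Q (2 * (phi + 1) * w1 - (s1 + w1)) (2 * (phi + 1) * w2 - (t1 + w2))
          - Q (s1 + w1) (t1 + w2) =
          4 * ((phi + 1) * (phi * Q w1 w2 - P)) by rewrite /P /Q; ring.
      by rewrite h subrr; lra.
    have e3 : phi * Q w1 w2 - P = 0 by lra.
    apply: (mulIf (lt0r_neq0 Qw)); rewrite QP in e3 *; lra.
  have := Muv s1 t1; rewrite -/phi phiE.
  have -> : 2 * (1 / 2) * (s1 + s2) - s1 = s2 by field.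
  by have -> : 2 * (1 / 2) * (t1 + t2) - t1 = t2 by field.
pose k := M 1 0 ^+ 2 / a.
exists (k * a), (k * b), (k * c) => s t.
have -> : k * a * s ^+ 2 + 2 * (k * b) * s * t + k * c * t ^+ 2 = k * Q s t.
  by rewrite /Q; ring.
(* [(l, 0)] lies on the level curve of [Q] through [(s, t)]. *)
pose l := Num.sqrt (Q s t / a).
have l2 : l ^+ 2 = Q s t / a by rewrite sqr_sqrtr// divr_ge0// ltW.
have -> : M s t = M (l * 1) (l * 0).
  apply: QM; rewrite mulr1 mulr0 {2}/Q l2; field.
  by rewrite gt_eqF.
rewrite MZ exprMn real_normK ?num_real// l2 /k; field.
by rewrite gt_eqF.
Qed.

End Quadratic.

(** * Planes and Auerbach bases *)

Definition lin_indep2 (R : realType) (n : nat) (x y : 'rV[R]_n) :=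
  forall s t, s *: x + t *: y = 0 -> s = 0 /\ t = 0.

Section Plane.
Variables (R : realType) (n : nat) (N : 'rV[R]_n -> R).
Hypothesis NN : vector_norm N.
Implicit Types x y : 'rV[R]_n.

Lemma plane_lower_bound x y : lin_indep2 x y ->
  exists2 e, 0 < e & forall s t, e * (s ^+ 2 + t ^+ 2) <= N (s *: x + t *: y) ^+ 2.
Proof.
move=> xy; pose F (p : R * R) := N (p.1 *: x + p.2 *: y).
have c1 : continuous (fun p : R * R => p.1) by move=> p; exact: cvg_fst.
have c2 : continuous (fun p : R * R => p.2) by move=> p; exact: cvg_snd.
have cF : continuous F.
  apply: vnorm_comp_continuous => //; apply: addmx_continuous;
    by apply: scalemx_continuous => //; exact: cst_continuous.
pose C := [set p : R * R | p.1 ^+ 2 + p.2 ^+ 2 = 1].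
have C_cpt : compact C.
  apply: (@subclosed_compact _ _ (`[-1 : R, 1]%classic `*` `[-1 : R, 1]%classic)).
  - apply: closed_fun_eq; last exact: cst_continuous.
    by apply: addf_continuous; exact: mulf_continuous.
  - by apply: compact_setX; exact: segment_compact.
  - move=> [s t]; rewrite /C/= => st; have := sqr_ge0 s;
    have := sqr_ge0 t => t0 s0.
    by split; rewrite /= in_itv/=; apply/andP; split; nra.
have C0 : C !=set0 by exists (1, 0); rewrite /C/= expr1n expr0n addr0.
have [[s0 t0] st1 cmin] := compact_min C0 C_cpt cF.
have F0 : 0 < F (s0, t0).
  apply: (vnorm_gt0 NN); apply/eqP => /xy[/= s00 t00]; move: st1;
    rewrite /C/= s00 t00.
  by rewrite expr0n addr0 => /esym/eqP; rewrite oner_eq0.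
exists (F (s0, t0) ^+ 2); first by rewrite exprn_gt0.
move=> s t; have [/eqP|st0] := eqVneq (s ^+ 2 + t ^+ 2) 0.
  rewrite paddr_eq0 ?sqr_ge0// !sqrf_eq0 => /andP[/eqP-> /eqP->].
  by rewrite expr0n addr0 mulr0 sqr_ge0.
have r2 : 0 < s ^+ 2 + t ^+ 2 by rewrite lt0r st0 addr_ge0 ?sqr_ge0.
pose r := Num.sqrt (s ^+ 2 + t ^+ 2).
have r0 : 0 < r by rewrite sqrtr_gt0.
have rE : r ^+ 2 = s ^+ 2 + t ^+ 2 by rewrite sqr_sqrtr// ltW.
have /cmin : C (s / r, t / r).
  by rewrite /C/= !expr_div_n -mulrDl rE divff.
have -> : s *: x + t *: y = r *: ((s / r) *: x + (t / r) *: y).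
  by rewrite scalerDr !scalerA ![r * _]mulrC !mulfVK ?gt_eqF.
rewrite (vnormZ NN) (gtr0_norm r0) exprMn rE => h; rewrite [leLHS]mulrC.
rewrite ler_wpM2l ?(ltW r2)// lerXn2r ?nnegrE//; first exact: ltW.
exact: vnorm_ge0.
Qed.

Lemma plane_quadratic x y :
  (forall z, z != 0 -> exists2 f, edot f z = 1 &
    forall v, N ((2 * edot f v) *: z - v) = N v) ->
  lin_indep2 x y -> exists a b c, forall s t,
    N (s *: x + t *: y) ^+ 2 = a * s ^+ 2 + 2 * b * s * t + c * t ^+ 2.
Proof.
move=> NR xy;
  apply: (@quadratic_of_reflections _ (fun s t => N (s *: x + t *: y))).
- by move=> c s t; rewrite -!scalerA -scalerDr (vnormZ NN).
- exact: plane_lower_bound.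
- move=> s0 t0 st0; have [|f fz fN] := NR (s0 *: x + t0 *: y).
    by apply/eqP => /xy[s00 t00]; move: st0; rewrite s00 t00 eqxx.
  exists (edot f x), (edot f y); split; first by rewrite -fz edotDr !edotZr.
  move=> s t; rewrite -[RHS]fN edotDr !edotZr; congr N.
  by apply/rowP => i; rewrite !mxE; ring.
Qed.

End Plane.

Lemma det_continuous (R : realType) (n : nat) (T : topologicalType)
  (f : T -> 'M[R]_n) : continuous f -> continuous (fun t => \det (f t)).
Proof.
move=> cf; apply: sum_continuous => s; apply: mulf_continuous;
  first exact: cst_continuous.
by apply: prod_continuous => i; exact: coordf_continuous.
Qed.

Section Auerbach.
Variables (R : realType) (n : nat) (N : 'rV[R]_n -> R).
Hypothesis NN : vector_norm N.

(* [A] maximizes the volume among matrices whose rows lie in the unit ball. *)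
Lemma auerbach_flag : exists A : 'M[R]_n, [/\ A \in unitmx,
  forall i, N (row i A) <= 1 &
  forall (k : 'I_n) (c : 'rV[R]_n), (forall j : 'I_n, (k < j)%N -> c 0 j = 0) ->
    `|c 0 k| <= N (c *m A)].
Proof.
have [c0 c0_gt0 cN] := vnorm_lb NN; have [c1 c1_gt0 Nc] := vnorm_ub NN.
pose S := [set v : 'rV[R]_(n * n) | forall i, N (row i (vec_mx v)) <= 1].
have cvec : continuous (fun v : 'rV[R]_(n * n) => vec_mx v : 'M[R]_n).
  apply: mx_continuous => i j; under eq_fun do rewrite mxE.
  exact: coord_continuous.
have S_cpt : compact S.
  apply: bounded_closed_compact.
    exists (c0^-1); split; first exact: num_real.
    move=> r cr v vS; apply: ltW; apply: le_lt_trans cr.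
    apply: normr_rV_le => [|ij]; first by rewrite invr_ge0 ltW.
    case/mxvec_indexP: ij => i j.
    have -> : v 0 (mxvec_index i j) = row i (vec_mx v) 0 j by rewrite !mxE.
    rewrite -[leRHS]mul1r ler_pdivlMr// mulrC.
    apply: le_trans (vS i); apply: le_trans (cN _);
      rewrite ler_wpM2l ?(ltW c0_gt0)//.
    rewrite [leRHS]/Num.norm/= mx_normrE.
    by apply: (le_bigmax _ (fun ij => `|row i (vec_mx v) ij.1 ij.2|) (0, j)).
  apply: closed_forall => i; apply: closed_fun_le; last exact: cst_continuous.
  apply: vnorm_comp_continuous => //; apply: mx_continuous => k l.
  under eq_fun do rewrite mxE.
  exact: coordf_continuous.
pose F (v : 'rV[R]_(n * n)) := `|\det (vec_mx v : 'M[R]_n)|.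
have cF : continuous F by apply: normf_continuous; exact: det_continuous.
have S0 : S (mxvec (c1^-1)%:M).
  move=> i; rewrite mxvecK (le_trans (Nc _))// -ler_pdivlMl// mulr1.
  apply: normr_rV_le => [|j]; first by rewrite invr_ge0 ltW.
  rewrite !mxE; case: eqP => _; first by rewrite mulr1n gtr0_norm ?invr_gt0.
  by rewrite mulr0n normr0 invr_ge0 ltW.
have [v vS vmax] := compact_max (ex_intro _ _ S0) S_cpt cF.
pose A : 'M[R]_n := vec_mx v.
have D0 : 0 < `|\det A|.
  apply: lt_le_trans (vmax _ S0); rewrite /F mxvecK det_scalar normr_gt0.
  by rewrite expf_neq0// invr_eq0 gt_eqF.
exists A; split=> //.
  by rewrite unitmxE unitfE -normr_gt0.
move=> k c ck; rewrite leNgt; apply/negP => Nck.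
have NcA := vnorm_ge0 NN (c *m A).
have E0 : 0 < N (c *m A) + `|c 0 k| by lra.
(* This scale separates the two sides of [Nck]: [l * N (c *m A) < 1], while [l] times the absolute
   value of [c 0 k] exceeds 1. *)
pose l := 2 / (N (c *m A) + `|c 0 k|).
have l0 : 0 < l by rewrite divr_gt0.
have lE : l * (N (c *m A) + `|c 0 k|) = 2 by rewrite mulfVK// gt_eqF.
(* [T *m A] is [A] with row [k] replaced by [l *: (c *m A)]. As [c] vanishes past [k], [T] is lower
   triangular and its determinant is [l * c 0 k], which contradicts maximality. *)
pose T : 'M[R]_n := \matrix_(i, j) if i == k then l * c 0 j else (i == j)%:R.
have Trow i : row i T = if i == k then l *: c else delta_mx 0 i.
  apply/rowP => j; rewrite !mxE; case: eqP => _; rewrite !mxE ?eqxx//.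
  by rewrite eq_sym.
have ST : S (mxvec (T *m A)).
  move=> i; rewrite mxvecK row_mul Trow; case: eqP => _; last first.
    by rewrite -rowE; exact: vS.
  rewrite -scalemxAl (vnormZ NN) gtr0_norm//.
  by move: lE; clearbody l; nra.
have detT : \det T = l * c 0 k.
  rewrite det_trig; last first.
    apply/is_trig_mxP => i j ij; rewrite mxE; case: eqP => [ik|_].
      by rewrite ck ?mulr0// -ik.
    by have [ijE|//] := eqVneq i j; rewrite ijE ltnn in ij.
  rewrite (bigD1 k)//= mxE eqxx big1 ?mulr1// => i /negbTE ik.
  by rewrite mxE ik eqxx.
have := vmax _ ST;
  rewrite /F mxvecK det_mulmx normrM -/A detT normrM (gtr0_norm l0).
rewrite -[leRHS]mul1r ler_pM2r//.
by move: lE; clearbody l; nra.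
Qed.

(** Coordinates are added one at a time. On the plane of [v], a combination of the earlier rows, and
    the next row [e], the flag inequality forces the cross term of the quadratic form to vanish,
    which is Pythagoras. *)
Lemma euclidean_of_planes :
  (forall x y, lin_indep2 x y -> exists a b c, forall s t,
    N (s *: x + t *: y) ^+ 2 = a * s ^+ 2 + 2 * b * s * t + c * t ^+ 2) ->
  exists2 A : 'M[R]_n, A \in unitmx & forall w, N (w *m A) = euclidean_norm w.
Proof.
move=> NQ; have [A [Au rowA flagA]] := auerbach_flag.
exists A => //.
suff H m (c : 'rV[R]_n) : (forall j : 'I_n, (m <= j)%N -> c 0 j = 0) ->
    N (c *m A) ^+ 2 = \sum_i c 0 i ^+ 2.
  move=> w; rewrite /euclidean_norm -(H n) => [|j];
    last by rewrite leqNgt ltn_ord.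
  by rewrite sqrtr_sqr ger0_norm// vnorm_ge0.
elim: m c => [|m ih] c cm.
  have -> : c = 0 by apply/rowP => j; rewrite mxE cm.
  by rewrite mul0mx (vnorm0 NN) expr0n big1// => i _; rewrite mxE expr0n.
have [nm|mn] := leqP n m.
  by apply: ih => j; rewrite leqNgt (leq_trans (ltn_ord j) nm).
pose k := Ordinal mn.
pose c' : 'rV[R]_n := \row_j if j == k then 0 else c 0 j.
have c'm (j : 'I_n) : (m <= j)%N -> c' 0 j = 0.
  rewrite mxE leq_eqVlt; case: (eqVneq j k) => // jk /orP[/eqP mj|];
    last exact: cm.
  by case/eqP: jk; apply: val_inj.
have cE : c = c' + c 0 k *: delta_mx 0 k.
  apply/rowP => j; rewrite !mxE eqxx/=; case: eqVneq => [->|_].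
    by rewrite mulr1 add0r.
  by rewrite mulr0 addr0.
pose e := row k A; pose v := c' *m A.
have cA s t : (s *: c' + t *: delta_mx 0 k) *m A = s *: v + t *: e.
  by rewrite mulmxDl -!scalemxAl -rowE.
have Nflag s t : `|t| <= N (s *: v + t *: e).
  rewrite -cA; have := flagA k (s *: c' + t *: delta_mx 0 k).
  have -> : (s *: c' + t *: delta_mx 0 k) 0 k = t.
    by rewrite !mxE !eqxx mulr0 add0r mulr1.
  apply=> j kj; rewrite !mxE.
  case: (eqVneq j k) => [jk|_]; first by rewrite jk ltnn in kj.
  by rewrite (cm j kj) !mulr0 addr0.
have Ne : N e = 1.
  apply/eqP; rewrite eq_le rowA/=; have := Nflag 0 1.
  by rewrite scale0r add0r scale1r normr1.
have -> : \sum_i c 0 i ^+ 2 = N v ^+ 2 + c 0 k ^+ 2.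
  rewrite (ih c' c'm) (bigD1 k)//= [in RHS](bigD1 k)//= mxE eqxx expr0n add0r addrC.
  by congr (_ + _); apply: eq_bigr => i /negbTE ik; rewrite mxE ik.
have -> : c *m A = 1 *: v + c 0 k *: e by rewrite -cA scale1r -cE.
have [v0|v0] := eqVneq v 0.
  by rewrite v0 scaler0 add0r (vnormZ NN) Ne mulr1 real_normK ?num_real//
    (vnorm0 NN) expr0n add0r.
have [|al [be [ga Q]]] := NQ v e.
  move=> s t st; have t0 : t = 0.
    apply/eqP; rewrite -normr_le0.
    by have := Nflag s t; rewrite st (vnorm0 NN).
  split=> //; move: st; rewrite t0 scale0r addr0 => /eqP.
  by rewrite scaler_eq0 (negbTE v0) orbF => /eqP.
have ga1 : ga = 1.
  have := Q 0 1; rewrite scale0r add0r scale1r Ne; lra.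
have alE : al = N v ^+ 2.
  have := Q 1 0; rewrite scale0r addr0 scale1r => ->; lra.
have al0 : 0 <= al by rewrite alE sqr_ge0.
have Qt s t : t ^+ 2 <= al * s ^+ 2 + 2 * be * s * t + ga * t ^+ 2.
  rewrite -Q -(real_normK (num_real t)) lerXn2r ?nnegrE//.
  exact: vnorm_ge0.
have be0 : be = 0.
  (* At this test point [Qt] reads [be ^+ 2 * (al + 2) <= 0]. *)
  have := Qt (- be) (al + 1); rewrite ga1 => h.
  have : be ^+ 2 * (al + 2) <= 0 by lra.
  have := sqr_ge0 be => b0 b1.
  by apply/eqP; rewrite -sqrf_eq0 eq_le b0 andbT; nra.
by rewrite Q alE be0 ga1; ring.
Qed.

End Auerbach.

Lemma euclidean_of_intuitive (R : realType) (n : nat) (N : 'rV[R]_n -> R) :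
  (3 <= n)%N -> vector_norm N ->
  (forall (P : {fset 'rV[R]_n}) (W : 'rV[R]_n -> R),
    P != fset0 -> prob_weights P W ->
    exists2 m, convex_hull [set` P] m &
    forall z, \sum_(p <- P) W p * N (m - p) <= \sum_(p <- P) W p * N (z - p)) ->
  exists2 A : 'M[R]_n, A \in unitmx & forall w, N (w *m A) = euclidean_norm w.
Proof.
move=> n3 NN NI; apply: euclidean_of_planes => // x y;
  apply: plane_quadratic => //.
apply: all_reflection => // z f; apply: smooth_reflection => //.
exact: subspace_contraction.
Qed.

(** * The norm of a convex body *)

Section NormBody.
Variables (R : realType) (n : nat) (K : set 'rV[R]_n).
Hypothesis KB : symmetric_convex_body K.
Implicit Types v x y : 'rV[R]_n.

Let K_conv x y t : 0 <= t -> t <= 1 -> K x -> K y -> K (t *: x + (1 - t) *: y).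
Proof. by have [_ /convex_setP cK _ _] := KB; exact: cK. Qed.

Lemma body_oppr v : K (- v) <-> K v.
Proof.
have [_ _ _ KN] := KB.
suff H w : K w -> K (- w) by split=> /H; rewrite ?opprK.
by move=> Kw; rewrite -KN; exists w.
Qed.

Lemma body_ball : exists2 r, 0 < r & forall v, `|v| < r -> K v.
Proof.
have [_ _ [x0 Kx0] _] := KB.
have /nbhs_ballP[r r0 xr] : nbhs x0 K by exact: Kx0.
exists r => // v vr.
have H x : `|x| < r -> K (x0 + x).
  move=> xr'; apply: xr; rewrite -ball_normE /=.
  by rewrite opprD addrA subrr add0r normrN.
(* [v] is the midpoint of [x0 + v] and [v - x0]; the latter lies in [K] by symmetry. *)
have Kv := H v vr.
have Knv : K (v - x0) by apply/body_oppr; rewrite opprB; apply: H;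
  rewrite normrN.
have := K_conv (t := 1 / 2) _ _ Kv Knv.
have -> : 1 / 2 *: (x0 + v) + (1 - 1 / 2) *: (v - x0) = v.
  by apply/rowP => i; rewrite !mxE; field.
by apply; lra.
Qed.

Lemma body_bounded : exists2 r, 0 < r & forall v, K v -> `|v| <= r.
Proof.
have [cK _ _ _] := KB; have [M [_ KM]] := compact_bounded cK.
exists (`|M| + 1); first by rewrite ltr_wpDl.
by move=> v Kv; apply: KM => //; rewrite (le_lt_trans (ler_norm _))// ltrDl.
Qed.

Lemma body0 : K 0.
Proof. by have [r r0 H] := body_ball; apply: H; rewrite normr0. Qed.

Lemma body_scale c v : 0 <= c -> c <= 1 -> K v -> K (c *: v).
Proof.
by move=> c0 c1 Kv; have := K_conv c0 c1 Kv body0; rewrite scaler0 addr0.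
Qed.

Lemma body_ray v : (forall c, 0 < c -> c < 1 -> K (c *: v)) -> K v.
Proof.
move=> Kc; have [cK _ _ _] := KB.
have clK : closed K by apply: compact_closed => //; exact: norm_hausdorff.
apply: contrapT => nKv.
have : nbhs v (~` K) by apply: open_nbhs_nbhs; split=> //; exact: closed_openC.
move=> /nbhs_ballP[e /= e0 eK].
have D0 : 0 < `|v| + 2 * e by rewrite ltr_wpDl// mulr_gt0.
pose d := e / (`|v| + 2 * e).
have d0 : 0 < d by rewrite divr_gt0.
have dE : d * (`|v| + 2 * e) = e by rewrite mulfVK// gt_eqF.
have v0 : 0 <= d * `|v| by rewrite mulr_ge0// ltW.
have d1 : d < 1 by rewrite ltr_pdivrMr//; have : 0 <= `|v| by []; lra.
have de : 0 < d * e by rewrite mulr_gt0.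
apply: (eK ((1 - d) *: v)); last by apply: Kc; lra.
rewrite -ball_normE/= scalerBl scale1r opprB addrCA subrr addr0 normrZ gtr0_norm//.
lra.
Qed.

(** Closedness of [K] along rays makes the infimum attained; the norm axioms are then read off from
    sublevel sets. *)
Lemma norm_body_leP v t : 0 < t -> norm_body K v <= t <-> K (t^-1 *: v).
Proof.
move=> t0; pose G := [set t : R | 0 < t /\ [set t *: x | x in K] v].
have GP s : G s <-> 0 < s /\ K (s^-1 *: v).
  split=> [[s0 [x Kx xv]]|[s0 Kv]]; split=> //.
    by rewrite -xv scalerA mulVf ?gt_eqF// scale1r.
  by exists (s^-1 *: v) => //; rewrite scalerA divff ?gt_eqF// scale1r.
have lG : lbound G 0 by move=> s /GP[/ltW].
split=> [Nt|Kv]; last by apply: ge_inf; [exists 0|exact/GP].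
have G0 : G !=set0.
  have [r r0 rK] := body_ball; pose s := (`|v| + r) / r.
  have s0 : 0 < s by rewrite divr_gt0// ltr_wpDl.
  exists s; apply/GP; split=> //; apply: rK.
  rewrite normrZ gtr0_norm ?invr_gt0// invf_div mulrAC -mulrA -[ltRHS]mulr1.
  by rewrite ltr_pM2l// ltr_pdivrMr ?ltr_wpDl// mul1r ltrDl.
apply: body_ray => c c0 c1.
have : inf G < t / c.
  by rewrite (le_lt_trans Nt)// ltr_pdivlMr// mulrC gtr_pMl.
move=> /(inf_lt G0)[s /GP[s0 Ks] st].
have -> : c *: (t^-1 *: v) = (c * s / t) *: (s^-1 *: v).
  by rewrite !scalerA; congr (_ *: _); field; rewrite !gt_eqF.
apply: body_scale => //; first by rewrite divr_ge0 ?mulr_ge0// ltW.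
by rewrite ler_pdivrMr// mul1r mulrC -ler_pdivlMr// ltW.
Qed.

Lemma norm_body_ge0 v : 0 <= norm_body K v.
Proof.
rewrite leNgt; apply/negP => N0.
have [r r0 rK] := body_bounded.
have H t : 0 < t -> `|v| <= r * t.
  move=> t0; have /(norm_body_leP v t0)/rK : norm_body K v <= t by lra.
  by rewrite normrZ gtr0_norm ?invr_gt0// mulrC ler_pdivrMr.
have v0 : v = 0.
  apply/eqP; rewrite -normr_le0; apply/ler_addgt0Pr => e e0; rewrite add0r.
  by have := H (e / r); rewrite mulrCA divff ?gt_eqF// mulr1; apply;
    rewrite divr_gt0.
move: N0; rewrite ltNge => /negP; apply.
apply: lb_le_inf; last by move=> t [/ltW].
by exists 1; split=> //; exists 0; rewrite ?scaler0 ?v0//; exact: body0.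
Qed.

(** [norm_body_leP] describes positive levels only; equalities of norms are proved by comparing
    those. *)
Lemma eq_pos_le (a b : R) : 0 <= a -> 0 <= b ->
  (forall t, 0 < t -> a <= t <-> b <= t) -> a = b.
Proof.
move=> a0 b0 ab; apply/eqP; rewrite eq_le; apply/andP; split.
  by apply/ler_addgt0Pr => e e0; apply/ab; rewrite ?lerDl ?ltW// ltr_wpDl.
by apply/ler_addgt0Pr => e e0; apply/ab; rewrite ?lerDl ?ltW// ltr_wpDl.
Qed.

Lemma norm_bodyN v : norm_body K (- v) = norm_body K v.
Proof.
apply: eq_pos_le => [||t t0]; try exact: norm_body_ge0.
by rewrite !norm_body_leP// scalerN body_oppr.
Qed.

Lemma norm_body_vector_norm : vector_norm (norm_body K).
Proof.
have N0 : norm_body K 0 = 0.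
  apply: eq_pos_le => [||t t0] //; first exact: norm_body_ge0.
  by rewrite norm_body_leP// scaler0; split=> // _; [exact: ltW|exact: body0].
have ZP c v : 0 < c -> norm_body K (c *: v) = c * norm_body K v.
  move=> c0; apply: eq_pos_le => [||t t0].
  - exact: norm_body_ge0.
  - by rewrite mulr_ge0 ?norm_body_ge0// ltW.
  - rewrite -ler_pdivlMl// !norm_body_leP ?mulr_gt0 ?invr_gt0//.
    by rewrite scalerA invfM invrK mulrC.
split.
- move=> x y.
  have H s t : norm_body K x <= s -> norm_body K y <= t -> 0 < s -> 0 < t ->
      norm_body K (x + y) <= s + t.
    move=> + + s0 t0; have st0 : 0 < s + t by rewrite addr_gt0.
    rewrite !norm_body_leP// => Kx Ky.
    have := K_conv (t := s / (s + t)) _ _ Kx Ky.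
    have -> : (s / (s + t)) *: (s^-1 *: x) + (1 - s / (s + t)) *: (t^-1 *: y) =
        (s + t)^-1 *: (x + y).
      by apply/rowP => i; rewrite !mxE; field; rewrite !gt_eqF.
    apply; first by rewrite divr_ge0// ltW.
    by rewrite ler_pdivrMr// mul1r lerDl ltW.
  apply/ler_addgt0Pr => e e0.
  have -> : norm_body K x + norm_body K y + e =
    (norm_body K x + e / 2) + (norm_body K y + e / 2) by field.
  have e2 : 0 < e / 2 by rewrite divr_gt0.
  by apply: H; rewrite ?lerDl ?(ltW e2)// ltr_wpDl// norm_body_ge0.
- move=> c v; have [c0|c0|->] := ltgtP c 0.
  + rewrite -[c]opprK scaleNr norm_bodyN normrN ZP ?oppr_gt0//.
    by rewrite gtr0_norm// oppr_gt0.
  + by rewrite ZP// gtr0_norm.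
  + by rewrite scale0r N0 normr0 mul0r.
- have [r r0 rK] := body_bounded; exists r^-1; first by rewrite invr_gt0.
  move=> v; apply/ler_addgt0Pr => e e0.
  have t0 : 0 < norm_body K v + e by rewrite ltr_wpDl// norm_body_ge0.
  have /(norm_body_leP v t0)/rK : norm_body K v <= norm_body K v + e by rewrite lerDl ltW.
  rewrite normrZ gtr0_norm ?invr_gt0// mulrC ler_pdivrMr//.
  by rewrite ler_pdivrMl.
- have [r r0 rK] := body_ball; exists (2 / r); first by rewrite divr_gt0.
  move=> v; have [->|v0] := eqVneq v 0; first by rewrite N0 normr0 mulr0.
  have t0 : 0 < 2 / r * `|v| by rewrite mulr_gt0 ?divr_gt0 ?normr_gt0.
  rewrite norm_body_leP//; apply: rK.
  rewrite normrZ gtr0_norm ?invr_gt0//.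
  have -> : (2 / r * `|v|)^-1 * `|v| = r / 2.
    by field; rewrite normr_eq0 v0 gt_eqF.
  by rewrite ltr_pdivrMr// mulr_natr mulr2n ltrDl.
Qed.

Lemma norm_body_le1 v : norm_body K v <= 1 <-> K v.
Proof. by rewrite norm_body_leP// invr1 scale1r. Qed.

End NormBody.

(** * Nearest points and ellipsoids *)

Lemma euclidean_normE (R : realType) (n : nat) (x : 'rV[R]_n) :
  euclidean_norm x = Num.sqrt (edot x x).
Proof. by []. Qed.

Lemma euclidean_normZ (R : realType) (n : nat) c (x : 'rV[R]_n) :
  euclidean_norm (c *: x) = `|c| * euclidean_norm x.
Proof.
by rewrite !euclidean_normE edotZl edotZr mulrA -expr2 sqrtrM ?sqr_ge0//
  sqrtr_sqr.
Qed.

Lemma convex_sum (R : realType) (n : nat) (C : set 'rV[R]_n) k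
    (p : 'I_k -> 'rV[R]_n) (c : 'I_k -> R) :
  convex_set C -> (forall i, C (p i)) -> (forall i, 0 <= c i) ->
  \sum_i c i = 1 -> C (\sum_i c i *: p i).
Proof.
move=> /convex_setP cC; elim: k p c => [|k ih] p c Cp c0.
  by rewrite big_ord0 => /eqP; rewrite eq_sym oner_eq0.
rewrite !big_ord_recl; set s := \sum_(i < k) _ => cs.
have s0 : 0 <= s by apply: sumr_ge0.
have [s_eq0|s_neq0] := eqVneq s 0.
  rewrite big1 ?addr0 => [|i _].
    by move: cs; rewrite s_eq0 addr0 => ->; rewrite scale1r.
  by rewrite (psumr_eq0P _ s_eq0)// scale0r.
have c1 : c ord0 <= 1 by rewrite -cs lerDl.
pose c' i := s^-1 * c (lift ord0 i).
have Cs : C (\sum_(i < k) c' i *: p (lift ord0 i)).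
  apply: ih => [i|i|]; first exact: Cp.
    by rewrite mulr_ge0// invr_ge0.
  by rewrite -mulr_sumr -/s mulVf.
have -> : \sum_(i < k) c (lift ord0 i) *: p (lift ord0 i) =
   (1 - c ord0) *: \sum_(i < k) c' i *: p (lift ord0 i).
  rewrite -cs addrAC subrr add0r scaler_sumr; apply: eq_bigr => i _.
  by rewrite scalerA mulrA divff// mul1r.
exact: cC.
Qed.

(** The convex combinations of the enumerated points of [P] are a linear image of a standard
    simplex, which is compact. *)
Lemma convex_hull_compact (R : realType) (n : nat) (P : {fset 'rV[R]_n}) :
  P != fset0 -> exists2 S : set 'rV[R]_n, S `<=` convex_hull [set` P] &
    [/\ S !=set0, compact S, convex_set S & [set` P] `<=` S].
Proof.
move=> P0; pose k := #|` P|; pose p (i : 'I_k) := (enum_fset P)`_i.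
have pP i : p i \in P by apply: mem_nth.
pose Delta := [set c : 'rV[R]_k | forall i, 0 <= c 0 i] `&` [set c | \sum_i c 0 i = 1].
pose f (c : 'rV[R]_k) := \sum_i c 0 i *: p i.
have PS : [set` P] `<=` f @` Delta.
  move=> x /= xP; have ik : (index x (enum_fset P) < k)%N by rewrite index_mem.
  exists (delta_mx 0 (Ordinal ik)).
    split=> /= [i|]; first by rewrite mxE.
    rewrite (bigD1 (Ordinal ik))//= mxE !eqxx big1 ?addr0// => i ni.
    by rewrite mxE eqxx (negbTE ni).
  rewrite /f (bigD1 (Ordinal ik))//= mxE !eqxx scale1r big1 ?addr0 => [|i ni].
    by rewrite /p/= nth_index.
  by rewrite mxE eqxx (negbTE ni) scale0r.
exists (f @` Delta).
  move=> _ [c [c0 c1] <-] C [cC PC].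
  by apply: convex_sum => // i; exact/PC/pP.
split=> //.
- by have [x xP] := fset0Pn _ P0; exists x; exact: PS.
- apply: continuous_compact.
    apply: continuous_subspaceT; apply: mx_continuous => i j.
    under eq_fun do rewrite summxE.
    apply: sum_continuous => l; under eq_fun do rewrite mxE.
    apply: mulf_continuous; last exact: cst_continuous.
    exact: coord_continuous.
  apply: bounded_closed_compact.
    exists 1; split; first exact: num_real.
    move=> r r1 c [c0 c1]; apply: normr_rV_le => [|i]; first lra.
    rewrite ger0_norm//; apply: le_trans (ltW r1);
      rewrite -c1 (bigD1 i)//= lerDl.
    by apply: sumr_ge0.
  apply: closedI.
    apply: closed_forall => i; apply: closed_fun_le;
      first exact: cst_continuous.
    exact: coord_continuous.
  apply: closed_fun_eq; last exact: cst_continuous.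
  by apply: sum_continuous => i; exact: coord_continuous.
- apply/convex_setP => _ _ t t0 t1 [c [c0 c1] <-] [d [d0 d1] <-].
  exists (t *: c + (1 - t) *: d).
    split=> /= [i|]; first by rewrite !mxE addr_ge0// mulr_ge0// subr_ge0.
    under eq_bigr do rewrite !mxE.
    by rewrite big_split/= -!mulr_sumr c1 d1 !mulr1 addrC subrK.
  rewrite /f; under eq_bigr do rewrite !mxE scalerDl -!scalerA.
  by rewrite big_split/= -!scaler_sumr.
Qed.

(** At the point of [S] nearest to [z], the directions to [z] and to any [p] of [S] form a non-acute
    angle, so the side from [z] to [p] is the longest. *)
Lemma nearest_point (R : realType) (n : nat) (B : 'M[R]_n) (S : set 'rV[R]_n)
    (z : 'rV[R]_n) : S !=set0 -> compact S -> convex_set S ->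
  exists2 y, S y & forall p, S p ->
    euclidean_norm ((y - p) *m B) <= euclidean_norm ((z - p) *m B).
Proof.
move=> S0 cS /convex_setP vS.
pose h (s : 'rV[R]_n) := edot ((z - s) *m B) ((z - s) *m B).
have ch : continuous h.
  have c1 : continuous (fun s : 'rV[R]_n => (z - s) *m B).
    apply: mulmx_continuous; last exact: cst_continuous.
    apply: addmx_continuous; first exact: cst_continuous.
    by apply: oppmx_continuous => s; exact: cvg_id.
  exact: edot_continuous.
have [y Sy ymin] := compact_min S0 cS ch.
exists y => // p Sp.
pose a := (z - y) *m B; pose b := (p - y) *m B.
have D0 := edot_ge0 b.
have ab : edot a b <= 0.
  rewrite leNgt; apply/negP => g0.
  have E0 : 0 < edot a b + edot b b by lra.
  (* If the angle were acute, moving from [y] towards [p] by this [t] would change the squared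
     distance by [- t * (1 + t) * edot a b], a decrease. *)
  pose t := edot a b / (edot a b + edot b b).
  have t0 : 0 < t by rewrite divr_gt0.
  have t1 : t <= 1 by rewrite ler_pdivrMr// mul1r lerDl.
  have tE : t * (edot a b + edot b b) = edot a b by rewrite mulfVK// gt_eqF.
  have := ymin _ (vS _ _ _ (ltW t0) t1 Sp Sy); rewrite /h -/a.
  have -> : (z - (t *: p + (1 - t) *: y)) *m B = a - t *: b.
    rewrite /a /b scalemxAl -mulmxBl; congr (_ *m _).
    by apply/rowP => i; rewrite !mxE; ring.
  rewrite !(edotDl, edotDr, edotNl, edotNr, edotZl, edotZr) (edotC b a).
  have tu : 0 < t * edot a b by rewrite mulr_gt0.
  have ttu : 0 < t * (t * edot a b) by rewrite mulr_gt0.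
  have : t * (t * edot b b) = t * edot a b - t * (t * edot a b).
    by rewrite -[X in _ = t * X - _]tE; ring.
  clearbody t; lra.
rewrite !euclidean_normE ler_wsqrtr//.
have -> : (z - p) *m B = a - b.
  by rewrite /a /b -mulmxBl; congr (_ *m _); apply/rowP => i; rewrite !mxE;
    ring.
have -> : (y - p) *m B = - b by rewrite /b -mulNmx opprB.
rewrite !(edotDl, edotDr, edotNl, edotNr) (edotC b a); have := edot_ge0 a; lra.
Qed.

Lemma symmetric_ellipsoid (R : realType) (n : nat) (K : set 'rV[R]_n) :
  symmetric_convex_body K -> ellipsoid K ->
  exists2 A : 'M[R]_n, A \in unitmx & K = [set x | euclidean_norm (x *m A) <= 1].
Proof.
move=> KB [A [b [Au KE]]].
have KP x : K x <-> euclidean_norm ((x - b) *m invmx A) <= 1.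
  rewrite KE; split=> [[y yn <-]|xn]; first by rewrite addrK mulmxK.
  by exists ((x - b) *m invmx A) => //; rewrite mulmxKV// subrK.
exists (invmx A); first by rewrite unitmx_inv.
suff b0 : b = 0 by apply/seteqP; split=> x /=; rewrite KP b0 subr0.
pose c := b *m invmx A.
have [c0|c0] := eqVneq c 0.
  by rewrite -[b](mulmxKV Au) -/c c0 mul0mx.
have e0 : 0 < euclidean_norm c by rewrite euclidean_normE sqrtr_gt0 edot_gt0.
(* [l *: b] is the boundary point of the ellipsoid beyond its centre [b]; its opposite is at
   distance [2 * euclidean_norm c + 1] from the centre, so it falls outside [K]. *)
pose l := 1 + (euclidean_norm c)^-1.
have l1 : 1 < l by rewrite ltrDl invr_gt0.
have Kl : K (l *: b).
  apply/KP; rewrite mulmxBl -scalemxAl -/c -{2}[c]scale1r -scalerBl euclidean_normZ.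
  by rewrite /l addrC addKr gtr0_norm ?invr_gt0// mulVf ?gt_eqF.
have /KP := (body_oppr KB (l *: b)).2 Kl.
rewrite -opprD mulNmx mulmxDl -scalemxAl -/c -scaleN1r.
rewrite euclidean_normZ normrN1 mul1r -{2}[c]scale1r -scalerDl euclidean_normZ.
rewrite gtr0_norm; last by rewrite addr_gt0// (lt_trans ltr01).
have : l * euclidean_norm c = euclidean_norm c + 1.
  by rewrite mulrDl mul1r mulVf// gt_eqF.
by move=> lE; rewrite mulrDl lE mul1r addrAC gerDr leNgt addr_gt0.
Qed.

Lemma ellipsoid_intuitive (R : realType) (n : nat) (K : set 'rV[R]_n) :
  symmetric_convex_body K -> ellipsoid K -> intuitive K.
Proof.
move=> KB /(symmetric_ellipsoid KB)[A Au KE] P W P0 [W0 _].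
have NE v : norm_body K v = euclidean_norm (v *m A).
  apply: eq_pos_le => [||t t0]; first exact: norm_body_ge0.
    by rewrite euclidean_normE sqrtr_ge0.
  rewrite norm_body_leP// KE/= -scalemxAl euclidean_normZ gtr0_norm ?invr_gt0//.
  by rewrite ler_pdivrMl// mulr1.
have [S SP [S0 cS vS PS]] := convex_hull_compact P0.
have cF : continuous (GM_cost K P W).
  apply: sum_continuous => p; apply: mulf_continuous;
    first exact: cst_continuous.
  apply: vnorm_comp_continuous; first exact: norm_body_vector_norm.
  by apply: addmx_continuous; [move=> ?; exact: cvg_id|exact: cst_continuous].
have [x Sx xmin] := compact_min S0 cS cF.
exists x; split; last exact: SP.
(* A minimizer over [S] is a global one, since replacing [z] by its nearest point in [S] increases
   no term of the cost. *)
move=> z; have [y Sy yz] := nearest_point A z S0 cS vS.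
apply: le_trans (xmin _ Sy) _; rewrite /GM_cost big_seq [leRHS]big_seq.
by apply: ler_sum => p pP; rewrite ler_wpM2l ?W0// !NE; exact/yz/PS.
Qed.

Theorem theorem2 (R : realType) (n : nat) (K : set 'rV[R]_n)
    (hn : (3 <= n)%N) (hK : symmetric_convex_body K) :
  intuitive K <-> ellipsoid K.
Proof.
split; last exact: ellipsoid_intuitive.
move=> iK; have [|A Au NA] := euclidean_of_intuitive hn (norm_body_vector_norm hK).
  by move=> P W P0 PW; have [x [xmin xP]] := iK P W P0 PW; exists x.
exists A, 0; split=> //; apply/seteqP; split=> x.
  move=> /(norm_body_le1 hK) Kx; exists (x *m invmx A);
    last by rewrite addr0 mulmxKV.
  by rewrite /= -NA mulmxKV.
by move=> [w wn <-]; rewrite addr0; apply/(norm_body_le1 hK); rewrite NA.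
Qed.
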